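(* Let $d\le n$ and $k\le n$ be positive integers, $\bm a_1,\dots,\bm a_n\in\mathbb{R}^d$, $\lambda>0$, and $\tilde k:=\min\{k,d\}$. Define $$\nu_k^{\mathrm C}:=\min_{\bm x\in[0,1]^n}\left\{\operatorname{tr}\left(\left(\sum_{i\in[n]}x_i\bm a_i\bm a_i^{\top}+\lambda \bm I_d\right)^{-1}\right): \sum_{i\in[n]}x_i=k\right\},$$ $$\nu_k^{\mathrm M}:=\min_{\bm x\in[0,1]^n}\left\{\Phi\left(\sum_{i\in[n]}x_i\bm h_i\bm h_i^{\top}\right)+\frac{d-k}{\lambda}: \sum_{i\in[n]}x_i=k\right\},$$ $$\nu_k^{\mathrm N}:=\min_{\bm x\in[0,1]^n}\left\{\operatorname{conv}\Gamma\left(\sum_{i\in[n]}x_i\bm a_i\bm a_i^{\top};\lambda\right)+\frac{d-\tilde k}{\lambda}: \sum_{i\in[n]}x_i=k\right\},$$ with $\Phi$, $\bm h_i$, $\operatorname{conv}\Gamma$ as defined in the context. Then (i) $\nu_k^{\mathrm N}=\nu_k^{\mathrm C}$ for any $k\in[d,n]$; (ii) $\nu_k^{\mathrm N}\ge\nu_k^{\mathrm C}$ for any $k\in[d-1]$; and (iii) $\nu_k^{\mathrm N}\ge\nu_k^{\mathrm M}$ for any $k\in[n]$.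
   Context: $[n]=\{1,\dots,n\}$ and $[s,n]=\{s,\dots,n\}$; the constraint $\bm x\in[0,1]^n$ uses the real unit interval. $\mathcal S_+^m$ is the set of $m\times m$ symmetric positive semidefinite matrices. Let $\bm A\in\mathbb{R}^{d\times n}$ have columns $\bm a_1,\dots,\bm a_n$, let $\bm C=\bm A^{\top}\bm A+\lambda\bm I_n$ (positive definite), let $\bm C=\bm H^{\top}\bm H$ be its Cholesky factorization with $\bm H\in\mathbb{R}^{n\times n}$, and let $\bm h_i\in\mathbb{R}^n$ be the $i$-th column of $\bm H$. For $\bm Y\in\mathcal S_+^n$ with eigenvalues $\beta_1\ge\cdots\ge\beta_n\ge0$, $$\Phi(\bm Y):=\sum_{i\in[\iota]}\frac1{\beta_i}+\frac{(k-\iota)^2}{\sum_{i\in[\iota+1,n]}\beta_i},$$ where $0\le\iota\le k-1$ is the unique integer such that $\beta_\iota>\frac{1}{k-\iota}\sum_{i\in[\iota+1,n]}\beta_i\ge\beta_{\iota+1}$, with $\beta_0=\infty$. For $\bm X\in\mathcal S_+^d$ with eigenvalues $\sigma_1\ge\cdots\ge\sigma_d\ge0$, $\Gamma(\bm X;\lambda):=\sum_{i\in[\tilde k]}\frac1{\sigma_i+\lambda}$. The function $\operatorname{conv}\Gamma(\cdot;\lambda)$ is the convex envelope (largest convex underestimator) of $\Gamma(\cdot;\lambda)$ on $\mathcal S_+^d$; explicitly, $$\operatorname{conv}\Gamma(\bm X;\lambda)=\sum_{i\in[\eta]}\frac1{\sigma_i+\lambda}+\frac{(\tilde k-\eta)^2}{\sum_{i\in[\eta+1,d]}\sigma_i+(\tilde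 k-\eta)\lambda},$$ where $0\le\eta\le\tilde k-1$ is the unique integer with $\sigma_\eta>\frac1{\tilde k-\eta}\sum_{i\in[\eta+1,d]}\sigma_i\ge\sigma_{\eta+1}$, with $\sigma_0=\infty$. *)

(* Defs.v *)
From HB Require Import structures.
From mathcomp Require Import all_boot all_order all_algebra.
From mathcomp Require Import all_classical all_reals all_analysis.
Set Implicit Arguments.
Unset Strict Implicit.
Unset Printing Implicit Defensive.
Import Order.TTheory GRing.Theory Num.Theory.
Local Open Scope classical_set_scope.
Local Open Scope ring_scope.

Definition psd (R : realType) (m : nat) : set 'M[R]_m :=
  [set X | X^T = X /\ forall v : 'cV[R]_m, 0 <= (v^T *m X *m v) 0 0].

(* The eigenvalues of X with algebraic multiplicity, in nonincreasing order.
   At most one sequence satisfies the predicate, and one exists whenever X is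
   symmetric.  Indices start at 0, so the i-th largest one is (eigs X)`_i.-1. *)
Definition eigs (R : realType) (m : nat) (X : 'M[R]_m) : seq R :=
  xget [::] [set s : seq R |
    sorted >=%R s /\ char_poly X = \prod_(b <- s) ('X - b%:P)].

(* beta_i > (sum_(j > i) beta_j) / (k - i) >= beta_(i+1) in 1-based indexing;
   for i = 0 the strict inequality holds by the convention beta_0 = +oo. *)
Definition is_cut (R : realType) (k : nat) (b : seq R) (i : nat) : bool :=
  let avg := (\sum_(i <= j < size b) b`_j) / (k - i)%:R in
  ((0 < i)%N ==> (avg < b`_i.-1)) && (b`_i <= avg).

(* The index i < k is unique, so the choice made by [pick] is immaterial; the
   default 0 is never used for positive semidefinite Y and 0 < k <= n.  The
   denominators are positive as soon as \rank Y >= k, which is the case for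
   every Y = \sum_i x_i h_i h_i^T with x in [0,1]^n, \sum_i x_i = k and
   linearly independent h_i. *)
Definition Phi (R : realType) (n k : nat) (Y : 'M[R]_n) : R :=
  let b := eigs Y in
  if [pick i : 'I_k | is_cut k b i] is Some i then
    \sum_(j < i) (b`_j)^-1 + (k - i)%:R ^+ 2 / \sum_(i <= j < n) b`_j
  else 0.

Definition Gamma (R : realType) (d kt : nat) (lam : R) (X : 'M[R]_d) : R :=
  \sum_(i < kt) ((eigs X)`_i + lam)^-1.

(* The largest convex underestimator of f on D, as the pointwise supremum of
   all of them. *)
Definition convex_envelope (R : realType) (E : lmodType R) (D : set E)
    (f : E -> R) (X : E) : R :=
  sup [set g X | g in [set g : E -> R |
    convex_function D g /\ forall Y, D Y -> g Y <= f Y]].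

Definition weighted_gram (R : realType) (m n : nat) (A : 'M[R]_(m, n))
    (x : 'rV[R]_n) : 'M[R]_m :=
  \sum_(i < n) x 0 i *: (col i A *m (col i A)^T).

Definition is_cholesky (R : realType) (n : nat) (C H : 'M[R]_n) : Prop :=
  [/\ C = H^T *m H,
      forall i j : 'I_n, (j < i)%N -> H i j = 0 &
      forall i : 'I_n, 0 < H i i].

Definition feasible (R : realType) (n k : nat) : set 'rV[R]_n :=
  [set x | (forall i, 0 <= x 0 i <= 1) /\ \sum_(i < n) x 0 i = k%:R].

Definition is_min (R : realType) (T : Type) (D : set T) (f : T -> R) (v : R) :
    Prop :=
  (f @` D) v /\ lbound (f @` D) v.

Definition objC (R : realType) (d n : nat) (A : 'M[R]_(d, n)) (lam : R)
    (x : 'rV[R]_n) : R :=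
  \tr (invmx (weighted_gram A x + lam%:M)).

Definition objM (R : realType) (d n k : nat) (H : 'M[R]_n) (lam : R)
    (x : 'rV[R]_n) : R :=
  Phi k (weighted_gram H x) + (d%:R - k%:R) / lam.

Definition objN (R : realType) (d n k : nat) (A : 'M[R]_(d, n)) (lam : R)
    (x : 'rV[R]_n) : R :=
  let kt := minn k d in
  convex_envelope (@psd R d) (Gamma kt lam) (weighted_gram A x)
  + (d%:R - kt%:R) / lam.

(* Main.v *)
(* All three objectives are suprema of affine functions of x.  From
   1 / u = max_s (2 s - s^2 u), with u ranging over spectra and s nondecreasing,
   Gamma(X; lam) dominates every
     sum_(j < k) (2 s_j - lam s_j^2) - tr (W X),   W = Q^T diag(s_j^2) Q,
   because tr (W X) >= sum_j s_j^2 sigma_j(X) (rearrangement).  For suitable W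
   these minorants are exact at X: for Phi by a direct computation, for the
   convex envelope of Gamma because X is a convex combination of matrices whose
   tail spectrum is 0 or the common average (vertices of a hypersimplex), on
   which Gamma takes the value of the minorant.  On the compact feasible set a
   function with an exact affine minorant at each point attains its minimum.

   The inequalities hold pointwise.  With s_j = 1 / (sigma_j + lam) the minorant
   gives objC <= objN, and Gamma is objC itself when k >= d.  For objM <= objN
   the multipliers optimal for Phi at Y are used for Gamma at X: with
   D = diag(x), the matrix Y = H D H^T has the spectrum of
   D^(1/2) A^T A D^(1/2) + lam D, which is at most D^(1/2) A^T A D^(1/2) + lam I,
   while the traces of Y and X differ by exactly lam k. *)
Require Import Defs.
From HB Require Import structures.
From mathcomp Require Import all_boot all_order all_fingroup all_algebra.
From mathcomp Require Import all_classical all_reals all_analysis.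
From mathcomp Require Import finmap complex.
From mathcomp Require Import ring lra.
Set Implicit Arguments.
Unset Strict Implicit.
Unset Printing Implicit Defensive.
Import Order.TTheory GRing.Theory Num.Theory.
Import numFieldNormedType.Exports.
Local Open Scope classical_set_scope.
Local Open Scope ring_scope.

(** * The real spectral theorem *)

Lemma char_poly_conj (F : comNzRingType) n (P Q X : 'M[F]_n) :
  P *m Q = 1%:M -> char_poly (P *m X *m Q) = char_poly X.
Proof.
move=> PQ; rewrite /char_poly /char_poly_mx.
have PQ' : map_mx polyC P *m map_mx polyC Q = 1%:M by rewrite -map_mxM PQ map_mx1.
have -> : 'X%:M - map_mx polyC (P *m X *m Q) =
  map_mx polyC P *m ('X%:M - map_mx polyC X) *m map_mx polyC Q.
  rewrite mulmxBr mulmxBl !map_mxM; congr (_ - _).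
  by rewrite scalar_mxC -mulmxA PQ' mulmx1.
rewrite !det_mulmx mulrAC mulrC -det_mulmx.
by rewrite PQ' det1 mulr1.
Qed.

Lemma char_poly_diag (F : comNzRingType) n (D : 'rV[F]_n) :
  char_poly (diag_mx D) = \prod_(j < n) ('X - (D 0 j)%:P).
Proof.
rewrite char_poly_trig; last first.
  apply/is_trig_mxP => i j ij; rewrite mxE.
  by rewrite (_ : i == j = false) // -val_eqE /=; apply/negbTE; rewrite neq_ltn ij.
by apply: eq_bigr => i _; rewrite mxE eqxx mulr1n.
Qed.

(** Over the complex numbers [X] is Hermitian, hence unitarily diagonalizable with real spectrum. A
    real root of the characteristic polynomial then has an eigenvector over [R] itself. *)
Lemma symmetric_eigenvector (R : rcfType) n (X : 'M[R]_n.+1) : X^T = X ->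
  exists a (v : 'rV[R]_n.+1), v != 0 /\ v *m X = a *: v.
Proof.
move=> sX; pose Z := map_mx (real_complex R) X.
have hZ : Z \is hermsymmx.
  apply/is_hermitianmxP; rewrite expr0 scale1r; apply/matrixP => i j.
  rewrite !mxE -[in LHS]sX mxE /=.
  by apply/esym/eqP; rewrite eq_complex /= oppr0 !eqxx.
have := hermitian_spectral_diag_real hZ => /mxOverP /(_ 0 0) dR.
have /hermitian_normalmx /orthomx_spectralP Zs := hZ.
set d := spectral_diag Z 0 0 in dR.
have dE : d = real_complex R (complex.Re d).
  by rewrite (RRe_real dR).
have eZ : eigenvalue Z d.
  apply/eigenvalueP; exists (row 0 (spectralmx Z)).
    have /(congr1 (mulmx (spectralmx Z))) := Zs.
    rewrite !mulmxA mulmxV ?spectral_unit // mul1mx => ZE.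
    by rewrite -row_mul ZE row_mul row_diag_mx -scalemxAl -rowE.
  apply/eqP => r0; have := spectral_unit Z; rewrite -row_free_unit.
  move=> /row_freeP[B] /(congr1 (row 0)); rewrite row_mul r0 mul0mx row1.
  by move=> /rowP/(_ 0) /eqP; rewrite !mxE !eqxx /= eq_sym oner_eq0.
move: eZ; rewrite eigenvalue_root_char -map_char_poly dE fmorph_root.
rewrite -eigenvalue_root_char => /eigenvalueP[v vX v0].
by exists (complex.Re d), v.
Qed.

Lemma row_sqnorm_gt0 (R : realDomainType) n (w : 'rV[R]_n) :
  w != 0 -> 0 < (w *m w^T) 0 0.
Proof.
have E : (w *m w^T) 0 0 = \sum_j w 0 j ^+ 2.
  by rewrite mxE; apply: eq_bigr => j _; rewrite mxE.
move=> w0; rewrite lt_neqAle E sumr_ge0 ?andbT => [|i _]; last exact: sqr_ge0.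
apply: contra w0; rewrite eq_sym psumr_eq0 => [/allP w0|i _]; last exact: sqr_ge0.
apply/eqP/rowP => j; apply/eqP; rewrite mxE -sqrf_eq0.
by apply: w0; rewrite mem_index_enum.
Qed.

(** The reflection along [v - e] exchanges the unit vectors [e] and [v]. It degenerates for [v = e],
    where the identity serves. *)
Lemma householder (R : rcfType) n (v : 'rV[R]_n.+1) : v *m v^T = 1%:M ->
  exists P : 'M[R]_n.+1, [/\ P^T = P, P *m P = 1%:M & row 0 P = v].
Proof.
move=> vv; pose e : 'rV[R]_n.+1 := delta_mx 0 0.
have [ve|ve] := eqVneq v e.
  by exists 1%:M; rewrite trmx1 mul1mx row1 ve.
pose u := v - e; pose t := (u *m u^T) 0 0.
have ee : e *m e^T = 1%:M.
  by rewrite trmx_delta mul_delta_mx; apply/matrixP => i j; rewrite !ord1 !mxE.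
have uu : u *m u^T = t%:M by rewrite [LHS]mx11_scalar.
have ve1 : v *m e^T = (v 0 0)%:M.
  apply/matrixP => i j; rewrite !ord1 trmx_delta -colE !mxE //=.
have ev1 : e *m v^T = (v 0 0)%:M.
  by rewrite -[e]trmxK -trmx_mul ve1 tr_scalar_mx.
have tE : t = 2 - 2 * v 0 0.
  rewrite /t /u linearB /= mulmxBr !mulmxBl vv ee ve1 ev1 !mxE /=.
  by rewrite mulr1n; ring.
have t0 : t != 0
  by apply: lt0r_neq0; apply: row_sqnorm_gt0; rewrite subr_eq0.
exists (1%:M - (2 / t) *: (u^T *m u)); split.
- by rewrite linearB /= linearZ /= trmx_mul trmxK trmx1.
- rewrite mulmxBr !mulmxBl !mulmx1 !mul1mx -!scalemxAl -!scalemxAr.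
  rewrite -mulmxA (mulmxA u) uu mul_scalar_mx -scalemxAr !scalerA.
  move: (u^T *m u) => N; apply/matrixP => i j; rewrite !mxE; by field.
- rewrite rowE -/e mulmxBr mulmx1 -scalemxAr mulmxA.
  have -> : e *m u^T = (- t / 2)%:M.
    rewrite /u linearB /= mulmxBr ev1 ee -raddfB /= tE; congr _%:M; by field.
  rewrite mul_scalar_mx scalerA (_ : 2 / t * _ = -1); last by field.
  by rewrite scaleN1r opprK /u addrC subrK.
Qed.

(** Deflation: conjugation by a reflection whose first row is a unit eigenvector makes the first row
    of [M] a multiple of [e_0]. Symmetry then clears the first column, and induction handles the
    remaining block. *)
Lemma real_spectral (R : rcfType) n (X : 'M[R]_n) : X^T = X ->
  exists (Q : 'M[R]_n) (D : 'rV[R]_n),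
    Q *m Q^T = 1%:M /\ X = Q^T *m diag_mx D *m Q.
Proof.
elim: n X => [|n IH] X sX.
  by exists 1%:M, 0; split; rewrite [LHS]flatmx0 [RHS]flatmx0.
have [a [w [w0 wX]]] := symmetric_eigenvector sX.
pose q := (w *m w^T) 0 0.
have q0 : 0 < q by exact: row_sqnorm_gt0.
pose v := (Num.sqrt q)^-1 *: w.
have vX : v *m X = a *: v by rewrite -scalemxAl wX scalerA mulrC -scalerA.
have vv : v *m v^T = 1%:M.
  rewrite linearZ /= -scalemxAl -scalemxAr [w *m _]mx11_scalar -/q.
  rewrite !scale_scalar_mx mulrA -invfM -expr2 sqr_sqrtr ?ltW //.
  by rewrite mulVf // gt_eqF.
have [P [sP PP rP]] := householder vv.
pose M : 'M[R]_(1 + n) := P *m X *m P.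
have sM : M^T = M by rewrite /M !trmx_mul sP sX mulmxA.
have rM : row 0 M = a *: delta_mx 0 0.
  rewrite /M !row_mul rP vX -scalemxAl -rP; congr (_ *: _).
  by rewrite -row_mul PP row1.
have Mu : usubmx M = row_mx a%:M 0.
  apply/matrixP => i j; rewrite !mxE ord1.
  move/rowP/(_ j): rM; rewrite !mxE; rewrite (_ : lshift n 0 = 0) => [->|]; last exact/val_inj.
  case: (split_ordP j) => j' ->; rewrite !mxE.
    by rewrite !ord1 /= mulr1.
  by rewrite mulr0.
have Mur : ursubmx M = 0 by rewrite /ursubmx Mu row_mxKr.
have Mul : ulsubmx M = a%:M by rewrite /ulsubmx Mu row_mxKl.
have Mdl : dlsubmx M = 0 by rewrite -[dlsubmx M]trmxK trmx_dlsub sM Mur trmx0.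
have [Q [D [QQ ME]]] : exists (Q : 'M[R]_n) (D : 'rV[R]_n),
    Q *m Q^T = 1%:M /\ drsubmx M = Q^T *m diag_mx D *m Q.
  by apply: IH; rewrite trmx_drsub sM.
pose B : 'M[R]_(1 + n) := block_mx 1%:M 0 0 Q.
have tB : B^T = block_mx 1%:M 0 0 Q^T by rewrite /B tr_block_mx !trmx0 trmx1.
have BB : B *m B^T = 1%:M.
  rewrite tB /B mulmx_block !mulmx0 !mul0mx !mulmx1 QQ !addr0 !add0r.
  by rewrite -scalar_mx_block.
have ME' : M = B^T *m diag_mx (row_mx a%:M D : 'rV[R]_(1 + n)) *m B.
  rewrite tB /B diag_mx_row -[LHS]submxK Mul Mur Mdl ME.
  rewrite !mulmx_block !mulmx0 !mul0mx !mul1mx !mulmx1 !addr0 !add0r.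
  congr block_mx; last by rewrite mul0mx.
  by apply/matrixP => i j; rewrite !ord1 !mxE.
exists (B *m P : 'M[R]_(1 + n)), (row_mx a%:M D : 'rV[R]_(1 + n)); split.
  by rewrite (trmx_mul (B : 'M[R]_n.+1)) sP mulmxA -(mulmxA (B : 'M[R]_n.+1)) PP mulmx1.
have -> : X = P *m (M : 'M[R]_n.+1) *m P.
  by rewrite /M !mulmxA PP mul1mx -mulmxA PP mulmx1.
rewrite [in LHS]ME' (trmx_mul (B : 'M[R]_n.+1)) sP -!mulmxA; congr (P *m _).
Qed.

(** Weights are a function on [nat], so that sequences read by [nth] and the values of [level] fit
    without casts. *)
Definition spectral_mx (R : nzRingType) n (Q : 'M[R]_n) (w : nat -> R) : 'M[R]_n :=
  Q^T *m diag_mx (\row_(j < n) w j) *m Q.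

Lemma spectral_mxE (R : comNzRingType) n (Q : 'M[R]_n) w i j :
  spectral_mx Q w i j = \sum_(l < n) w l * (Q l i * Q l j).
Proof.
rewrite /spectral_mx mxE; apply: eq_bigr => l _.
by rewrite mul_mx_diag !mxE; ring.
Qed.

Lemma spectral_mxK (R : comUnitRingType) n (Q : 'M[R]_n) w : Q *m Q^T = 1%:M ->
  Q *m spectral_mx Q w *m Q^T = diag_mx (\row_(j < n) w j).
Proof.
by move=> QQ; rewrite /spectral_mx !mulmxA QQ mul1mx -mulmxA QQ mulmx1.
Qed.

Lemma char_poly_spectral (R : comUnitRingType) n (Q : 'M[R]_n) w :
  Q *m Q^T = 1%:M ->
  char_poly (spectral_mx Q w) = \prod_(b <- mkseq w n) ('X - b%:P).
Proof.
move=> QQ; rewrite char_poly_conj ?(mulmx1C QQ) // char_poly_diag.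
transitivity (\prod_(0 <= j < n) ('X - (w j)%:P)).
  by rewrite big_mkord; apply: eq_bigr => j _; rewrite mxE.
by rewrite /index_iota subn0 big_map.
Qed.

(** * Sorted spectra of symmetric matrices *)

Section Eigs.
Variable R : realType.

Lemma ge_trans_ring : transitive (>=%R : rel R).
Proof. exact/rev_trans/le_trans. Qed.

Lemma eigs_unique n (X : 'M[R]_n) (s : seq R) : sorted >=%R s ->
  char_poly X = \prod_(b <- s) ('X - b%:P) -> eigs X = s.
Proof.
move=> ss Xs; rewrite /eigs; apply: xget_unique; first by split.
move=> t [st Xt]; apply: (sorted_eq ge_trans_ring) => //.
  by move=> x y /andP[? ?]; apply/le_anti/andP.
by apply: prod_XsubC_eq; rewrite -Xt.
Qed.

Lemma eigs_spectral_mx n (Q : 'M[R]_n) w (s : seq R) : Q *m Q^T = 1%:M ->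
  sorted >=%R s -> perm_eq s (mkseq w n) -> eigs (spectral_mx Q w) = s.
Proof.
move=> QQ ss sw; apply: eigs_unique => //.
by rewrite char_poly_spectral // (perm_big _ sw).
Qed.

(** Sorting the diagonal of a spectral decomposition is a permutation, which the rows of [Q]
    absorb. *)
Lemma eigs_spectral n (X : 'M[R]_n) : X^T = X ->
  exists Q, [/\ Q *m Q^T = 1%:M, X = spectral_mx Q (nth 0 (eigs X)),
                size (eigs X) = n & sorted >=%R (eigs X)].
Proof.
move=> sX; have [Q [D [QQ XE]]] := real_spectral sX.
pose t := [tuple D 0 j | j < n].
have [s ss st] : exists2 s, sorted >=%R s & perm_eq s t.
  exists (sort >=%R t); last by rewrite perm_sort.
  by apply: sort_sorted => x y; exact: le_total.
have szs : size s = n by rewrite (perm_size st) size_tuple.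
have /tuple_permP[p sE] := st.
have snth (j : 'I_n) : s`_j = D 0 (p j).
  by rewrite sE (nth_map j) ?size_enum_ord // nth_ord_enum tnth_mktuple.
have XE' : X = spectral_mx (row_perm p Q) (nth 0 s).
  apply/matrixP => i j; rewrite XE spectral_mxE mxE (reindex_inj (@perm_inj _ p)).
  by apply: eq_bigr => l _; rewrite mul_mx_diag !mxE snth; ring.
have QQ' : row_perm p Q *m (row_perm p Q)^T = 1%:M.
  rewrite row_permE trmx_mul mulmxA -(mulmxA _ Q) QQ mulmx1.
  by rewrite tr_perm_mx -perm_mxM mulgV perm_mx1.
have Es : eigs X = s.
  rewrite XE'; apply: eigs_spectral_mx => //.
  by rewrite -[X in mkseq _ X]szs mkseq_nth.
by exists (row_perm p Q); rewrite Es; split.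
Qed.

Lemma eigs_nonincr n (X : 'M[R]_n) i j : X^T = X -> (i <= j < n)%N ->
  (eigs X)`_j <= (eigs X)`_i.
Proof.
move=> /eigs_spectral[Q [_ _ sz so]] /andP[ij jn].
apply: (sorted_leq_nth ge_trans_ring lexx 0 so) => //; rewrite inE sz //.
exact: leq_ltn_trans jn.
Qed.

Lemma eigs_ge0 n (X : 'M[R]_n) j : psd X -> 0 <= (eigs X)`_j.
Proof.
move=> [sX pX]; have [Q [QQ XE sz _]] := eigs_spectral sX.
have [jn|nj] := ltnP j n; last by rewrite nth_default ?sz.
have := pX (row (Ordinal jn) Q)^T.
have -> : ((row (Ordinal jn) Q)^T^T *m X *m (row (Ordinal jn) Q)^T) 0 0 =
    (Q *m X *m Q^T) (Ordinal jn) (Ordinal jn).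
  rewrite trmxK -row_mul; move: (Q *m X) => B; rewrite !mxE.
  by apply: eq_bigr => l _; rewrite !mxE.
by rewrite {1}XE spectral_mxK // !mxE eqxx mulr1n.
Qed.

End Eigs.

(** * Trace inequalities *)

(* The duality certificate: [a i + c j <= w i * b j], with equality on the
   diagonal, so that every doubly stochastic average dominates the diagonal. *)
Lemma rearrangement (R : realDomainType) n (w b : nat -> R)
    (M : 'I_n -> 'I_n -> R) :
  (forall i j, (i <= j < n)%N -> w i <= w j) ->
  (forall i j, (i <= j < n)%N -> b j <= b i) ->
  (forall i j, 0 <= M i j) ->
  (forall i, \sum_j M i j = 1) -> (forall j, \sum_i M i j = 1) ->
  \sum_(i < n) w i * b i <= \sum_(i < n) \sum_(j < n) M i j * (w i * b j).
Proof.
move=> w_le b_ge M0 Mr Mc.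
(* [a] sums [b] against the increments of [w], so [a i - a j] can be compared term by term with the
   telescoped [(w i - w j) * b j]. *)
pose a i := \sum_(0 <= l < i) (w l.+1 - w l) * b l.
pose c j := w j * b j - a j.
have ac (i j : 'I_n) : a i + c j <= w i * b j.
  suff : a i - a j <= (w i - w j) * b j by rewrite /c mulrBl; lra.
  have [ij|/ltnW ji] := leqP i j.
    rewrite -opprB /a (big_cat_nat (leq0n _) ij) //= addrAC subrr add0r.
    rewrite -[w i - w j]opprB mulNr lerN2 -(telescope_sumr w ij) mulr_suml.
    rewrite !big_nat; apply: ler_sum => l /andP[il lj]; apply: ler_wpM2l.
      by rewrite subr_ge0 w_le // leqnSn (leq_ltn_trans lj).
    by rewrite b_ge // (ltnW lj) /=.
  rewrite /a (big_cat_nat (leq0n _) ji) //= addrAC subrr add0r.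
  rewrite -(telescope_sumr w ji) mulr_suml.
  rewrite !big_nat; apply: ler_sum => l /andP[il lj]; apply: ler_wpM2l.
    by rewrite subr_ge0 w_le // leqnSn (leq_ltn_trans lj).
  by rewrite b_ge // il (ltn_trans lj).
have -> : \sum_(i < n) w i * b i = \sum_(i < n) \sum_(j < n) M i j * (a i + c j).
  transitivity (\sum_(i < n) a i + \sum_(j < n) c j).
    by rewrite -big_split; apply: eq_bigr => i _; rewrite /c /=; ring.
  rewrite [RHS](eq_bigr (fun i : 'I_n => a i + \sum_j M i j * c j)) => [|i _]; last first.
    rewrite -[in RHS](mul1r (a i)) -(Mr i) mulr_suml -big_split.
    by apply: eq_bigr => j _; rewrite mulrDr.
  rewrite [RHS]big_split /=; congr (_ + _); rewrite exchange_big; apply: eq_bigr => j _.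
  by rewrite -mulr_suml Mc mul1r.
by apply: ler_sum => i _; apply: ler_sum => j _; apply: ler_wpM2l.
Qed.

Lemma mxtrace_spectral (R : comUnitRingType) n (Q : 'M[R]_n) w :
  Q *m Q^T = 1%:M -> \tr (spectral_mx Q w) = \sum_(j < n) w j.
Proof.
move=> QQ; rewrite /spectral_mx mxtrace_mulC mulmxA QQ mul1mx mxtrace_diag.
by apply: eq_bigr => j _; rewrite mxE.
Qed.

Section Trace.
Variable R : realType.

Lemma mxtrace_eigs n (X : 'M[R]_n) : X^T = X ->
  \tr X = \sum_(j < n) (eigs X)`_j.
Proof.
by case/eigs_spectral => Q [QQ XE _ _]; rewrite [in LHS]XE mxtrace_spectral.
Qed.

(** In the two eigenbases the trace is an average of the products [w i * b j] with weights the
    squared entries of the orthogonal matrix [Q *m P^T], which form a doubly stochastic matrix. *)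
Lemma le_mxtrace_spectral n (X Q : 'M[R]_n) w : X^T = X -> Q *m Q^T = 1%:M ->
  (forall i j, (i <= j < n)%N -> w i <= w j) ->
  \sum_(j < n) w j * (eigs X)`_j <= \tr (spectral_mx Q w *m X).
Proof.
move=> sX QQ w_le; have [P [PP XE _ _]] := eigs_spectral sX.
set b := nth 0 (eigs X); pose M := Q *m P^T.
have MM : M *m M^T = 1%:M.
  by rewrite /M trmx_mul trmxK mulmxA -(mulmxA Q) (mulmx1C PP) mulmx1.
have -> : \tr (spectral_mx Q w *m X) =
    \sum_(i < n) \sum_(j < n) M i j ^+ 2 * (w i * b j).
  have -> : \tr (spectral_mx Q w *m X) =
      \tr (diag_mx (\row_j w j) *m (M *m diag_mx (\row_j b j) *m M^T)).
    rewrite {1}XE /spectral_mx -!mulmxA mxtrace_mulC /M trmx_mul trmxK.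
    by rewrite !mulmxA.
  apply: eq_bigr => i _; rewrite mul_diag_mx !mxE mulr_sumr; apply: eq_bigr => j _.
  by rewrite mul_mx_diag !mxE; ring.
apply: rearrangement => //.
- by move=> i j; exact: eigs_nonincr.
- by move=> i j; exact: sqr_ge0.
- move=> i; have /matrixP/(_ i i) := MM; rewrite mxE [RHS]mxE eqxx mulr1n => <-.
  by apply: eq_bigr => j _; rewrite [M^T _ _]mxE expr2.
- move=> j; have /matrixP/(_ j j) := mulmx1C MM; rewrite mxE [RHS]mxE eqxx mulr1n => <-.
  by apply: eq_bigr => i _; rewrite [M^T _ _]mxE expr2.
Qed.
End Trace.

(** * Averaging the tail of a spectrum *)

(* At the cut [i], [Phi] is the sum of the inverses of the first [k] entries. *)
Definition level (R : realType) (k : nat) (b : seq R) (i j : nat) : R :=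
  if (j < i)%N then b`_j else (\sum_(i <= l < size b) b`_l) / (k - i)%:R.

(* Equality holds at [s = u^-1], which makes the affine minorants exact. *)
Lemma le_inv_quadratic (R : realFieldType) (u s : R) :
  0 < u -> 2 * s - s ^+ 2 * u <= u^-1.
Proof.
move=> u0; rewrite -subr_ge0.
have -> : u^-1 - (2 * s - s ^+ 2 * u) = (1 - s * u) ^+ 2 / u.
  by field; rewrite gt_eqF.
by rewrite divr_ge0 ?sqr_ge0 ?ltW.
Qed.

Section Level.
Variables (R : realType) (n k : nat) (b : seq R).
Hypotheses (szb : size b = n) (le_kn : (k <= n)%N).
Hypothesis b_ge : forall i j, (i <= j < n)%N -> b`_j <= b`_i.
Hypothesis b_ge0 : forall j, 0 <= b`_j.

(** The least index whose tail average bounds its entry is a cut; [k.-1] always qualifies.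
    Minimality makes the preceding entry exceed the average that includes it, and taking that entry
    out of the average keeps the inequality strict. *)
Lemma cut_exists : (0 < k)%N -> exists i : 'I_k, is_cut k b i.
Proof.
move=> k0; pose S i := \sum_(i <= l < size b) b`_l.
pose p i := (i < k)%N && (b`_i <= S i / (k - i)%:R).
have S_rec i : (i < k)%N -> S i = b`_i + S i.+1.
  by move=> ik; rewrite /S big_ltn // szb (leq_trans ik).
have [|i /andP[ik bi] i_min] := @ex_minnP p.
  exists k.-1; rewrite /p prednK // leqnn /=.
  rewrite -subn1 subKn // divr1 S_rec ?subn1 ?prednK // lerDl sumr_ge0 // => l _.
exists (Ordinal ik); rewrite /is_cut /= -/(S i) bi andbT; apply/implyP.
case: i ik bi i_min => // i ik bi i_min _ /=.
have : ~~ p i by apply/negP => /i_min; rewrite ltnn.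
rewrite /p (ltnW ik) /= -ltNge S_rec ?(ltnW ik) //.
rewrite !ltr_pdivrMr ?ltr0n ?subn_gt0 ?(ltnW ik) //.
by rewrite -(subnSK (ltnW ik)) -natr1 mulrDr mulr1 addrC ltrD2r.
Qed.

Variable i : nat.
Hypothesis ik : (i < k)%N.
Let u := level k b i.

Lemma sum_level_split (F : nat -> R -> R) :
  \sum_(j < k) F j (u j) =
  \sum_(j < i) F j b`_j
  + \sum_(i <= j < k) F j ((\sum_(i <= l < size b) b`_l) / (k - i)%:R).
Proof.
rewrite -(big_mkord xpredT (fun j => F j (u j))) (big_cat_nat (leq0n i) (ltnW ik)).
rewrite big_mkord; congr (_ + _).
  by apply: eq_bigr => j _; rewrite /u /level ltn_ord.
by apply: eq_big_nat => j /andP[ij _]; rewrite /u /level ltnNge ij.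
Qed.

Lemma sum_level : \sum_(j < k) u j = \sum_(j < n) b`_j.
Proof.
rewrite (sum_level_split (fun _ x => x)) /= big_const_nat iter_addr_0.
rewrite -[X in _ + X]mulr_natr.
rewrite divfK ?pnatr_eq0 ?subn_eq0 -?ltnNge // szb.
rewrite -[RHS](big_mkord xpredT (fun j => b`_j)).
by rewrite (big_cat_nat (leq0n i) (leq_trans (ltnW ik) le_kn)) big_mkord.
Qed.

Hypothesis cut_i : is_cut k b i.

Lemma level_ge0 j : 0 <= u j.
Proof.
by rewrite /u /level; case: ifP => // _; rewrite divr_ge0 ?ler0n ?sumr_ge0.
Qed.

Lemma level_nonincr j l : (j <= l)%N -> u l <= u j.
Proof.
move=> jl; rewrite /u /level; case: (ltnP l i) => li.
  rewrite (leq_ltn_trans jl li) b_ge // jl (ltn_trans li) //.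
  exact: leq_trans ik le_kn.
case: ltnP => // ji; have /andP[/implyP H _] := cut_i.
have i0 : (0 < i)%N by apply: leq_ltn_trans ji.
apply: (le_trans (ltW (H i0))); apply: b_ge.
by rewrite -ltnS prednK // ji (leq_trans (ltnW ik)).
Qed.

(** The defect between [b] and its levels, extended by 0 beyond [k]. Its sum is 0, so weights can be
    shifted by a constant at no cost. *)
Let e j := b`_j - (if (j < k)%N then u j else 0).

Lemma sum_defect (w : nat -> R) :
  \sum_(j < n) w j * e j = \sum_(j < n) w j * b`_j - \sum_(j < k) w j * u j.
Proof.
rewrite (big_ord_widen n (fun j => w j * u j) le_kn).
rewrite [X in _ - X]big_mkcond -sumrB.
by apply: eq_bigr => j _; rewrite /e; case: ifP => _; rewrite mulrBr ?mulr0.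
Qed.

Lemma sum_defect0 : \sum_(j < n) e j = 0.
Proof.
have := sum_defect (fun=> 1); under eq_bigr do rewrite mul1r.
move=> ->; under eq_bigr do rewrite mul1r.
by under [X in _ - X]eq_bigr do rewrite mul1r; rewrite sum_level subrr.
Qed.

(** After subtracting [w k.-1] from the weights, weight and defect have the same sign: both are at
    most 0 before [k] and at least 0 from [k] on. *)
Lemma le_sum_level (w : nat -> R) :
  (forall j l, (j <= l < n)%N -> w j <= w l) ->
  \sum_(j < k) w j * u j <= \sum_(j < n) w j * b`_j.
Proof.
move=> w_le; rewrite -subr_ge0 -sum_defect.
have -> : \sum_(j < n) w j * e j = \sum_(j < n) (w j - w k.-1) * e j.
  under [RHS]eq_bigr do rewrite mulrBl.
  by rewrite sumrB -mulr_sumr sum_defect0 mulr0 subr0.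
have k0 : (0 < k)%N by apply: leq_ltn_trans ik.
apply: sumr_ge0 => j _; rewrite /e; case: ltnP => jk; last first.
  rewrite subr0 mulr_ge0 // subr_ge0 w_le // ltn_ord andbT.
  by rewrite (leq_trans _ jk) // leq_pred.
rewrite mulr_le0 // ?subr_le0.
  by rewrite w_le // -ltnS prednK // jk (leq_trans _ le_kn) // prednK.
rewrite /u /level; case: ltnP => // ij.
have /andP[_] := cut_i; apply: le_trans.
by apply: b_ge; rewrite ij ltn_ord.
Qed.

(** After subtracting [w i], every term vanishes: the defect before the cut, the weight from it
    on. *)
Lemma sum_level_const (w : nat -> R) : (forall j, (i <= j)%N -> w j = w i) ->
  \sum_(j < k) w j * u j = \sum_(j < n) w j * b`_j.
Proof.
move=> w_eq; apply/eqP; rewrite eq_sym -subr_eq0 -sum_defect; apply/eqP.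
have -> : \sum_(j < n) w j * e j = \sum_(j < n) (w j - w i) * e j.
  under [RHS]eq_bigr do rewrite mulrBl.
  by rewrite sumrB -mulr_sumr sum_defect0 mulr0 subr0.
apply: big1 => j _; case: (ltnP j i) => [ji|/w_eq ->]; last by rewrite subrr mul0r.
by rewrite /e /u /level ji (ltn_trans ji ik) subrr mulr0.
Qed.

Lemma level_dual_le (c : R) (s : nat -> R) :
  (forall j, (j < k)%N -> 0 < u j + c) -> (forall j, 0 <= s j) ->
  (forall j l, (j <= l < n)%N -> s j <= s l) ->
  \sum_(j < k) (2 * s j - c * s j ^+ 2) - \sum_(j < n) s j ^+ 2 * b`_j
  <= \sum_(j < k) (u j + c)^-1.
Proof.
move=> uc0 s0 s_le; have w_le j l : (j <= l < n)%N -> s j ^+ 2 <= s l ^+ 2.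
  by move=> /s_le; rewrite ler_pXn2r // nnegrE.
rewrite lerBlDr; apply: le_trans (lerD (lexx _) (le_sum_level w_le)).
rewrite -big_split; apply: ler_sum => j _ /=; rewrite -lerBlDr.
apply: le_trans (le_inv_quadratic (s j) (uc0 _ (ltn_ord j))).
by rewrite mulrDr opprD addrA addrAC [c * _]mulrC.
Qed.

(** The optimal multipliers are constant from the cut on, so replacing [b] by its levels loses
    nothing. The case [c = 0] serves [Phi], the case [c = lam] the envelope. *)
Lemma level_dual_eq (c : R) : (forall j, (j < k)%N -> 0 < u j + c) ->
  let s j := (u j + c)^-1 in
  \sum_(j < k) (2 * s j - c * s j ^+ 2) - \sum_(j < n) s j ^+ 2 * b`_j
  = \sum_(j < k) (u j + c)^-1.
Proof.
move=> uc0 s; rewrite -(@sum_level_const (fun j => s j ^+ 2)); last first.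
  by move=> j ij; rewrite /s /u /level ltnn ltnNge ij.
rewrite -sumrB; apply: eq_bigr => j _.
by rewrite /s; field; rewrite gt_eqF // uc0.
Qed.

End Level.

Lemma Phi_level (R : realType) n k (Y : 'M[R]_n) :
  (0 < k <= n)%N -> psd Y -> exists i, [/\ (i < k)%N, is_cut k (eigs Y) i &
    Phi k Y = \sum_(j < k) (level k (eigs Y) i j)^-1].
Proof.
move=> /andP[k0 kn] pY; have [sY _] := pY; have [_ [_ _ sz _]] := eigs_spectral sY.
rewrite /Phi; case: pickP => [i cut_i|no_cut]; last first.
  have [i cut_i] := cut_exists sz kn (fun j => eigs_ge0 j pY) k0.
  by have := no_cut i; rewrite cut_i.
exists i; split=> //; rewrite (sum_level_split _ (ltn_ord i) (fun _ x => x^-1)) /=.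
(* The last [k - i] levels all equal the tail sum over [k - i], so their inverses add up to
   [(k - i)^2] over that sum. *)
congr (_ + _); rewrite big_const_nat iter_addr_0 -[RHS]mulr_natr invf_div sz.
by rewrite expr2 mulrAC.
Qed.

(** * The convex envelope of Gamma *)

Lemma mul_spectral_mx (R : comUnitRingType) n (Q : 'M[R]_n) w v :
  Q *m Q^T = 1%:M ->
  spectral_mx Q w *m spectral_mx Q v = spectral_mx Q (fun j => w j * v j).
Proof.
move=> QQ; rewrite /spectral_mx !mulmxA -(mulmxA _ Q) QQ mulmx1.
rewrite -(mulmxA _ _ (diag_mx _)) mulmx_diag; congr (_ *m diag_mx _ *m _).
by apply/rowP => j; rewrite !mxE.
Qed.

Section Envelope.
Variables (R : realType) (E : lmodType R) (D : set E) (f : E -> R).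

Lemma convex_functionP (g : E -> R) : convex_function D g <->
  forall (t : R) x y, 0 <= t <= 1 -> D x -> D y ->
    g (t *: x + (1 - t) *: y) <= t * g x + (1 - t) * g y.
Proof.
split=> [cg t x y /andP[t0 t1] Dx Dy | cg t x y /set_mem Dx /set_mem Dy].
  by have := cg (Itv01 t0 t1) x y (mem_set Dx) (mem_set Dy).
have t0 : 0 <= t%:num by [].
have t1 : t%:num <= 1 by [].
by apply: cg => //; rewrite t0 t1.
Qed.

Lemma le_convex_envelope (g : E -> R) x : convex_function D g ->
  (forall y, D y -> g y <= f y) -> D x -> g x <= convex_envelope D f x.
Proof.
move=> cg gf Dx; apply: ub_le_sup; last by exists g.
by exists (f x) => _ [h [_ hf] <-]; exact: hf.
Qed.

(** [g0] witnesses that the family of underestimators is nonempty, so that [sup] is a true least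
    upper bound and not a default value. *)
Lemma convex_envelope_le (g0 : E -> R) x c : convex_function D g0 ->
  (forall y, D y -> g0 y <= f y) ->
  (forall g, convex_function D g -> (forall y, D y -> g y <= f y) -> g x <= c) ->
  convex_envelope D f x <= c.
Proof.
move=> cg0 g0f gc; apply: ge_sup; first by exists (g0 x), g0.
by move=> _ [g [cg gf] <-]; exact: gc.
Qed.

End Envelope.

(** * Affine minorants of [Gamma] and of its envelope *)

Section Gamma.
Variable R : realType.

Lemma psd_congr m n (B : 'M[R]_(m, n)) (w : 'rV[R]_n) :
  (forall j, 0 <= w 0 j) -> psd (B *m diag_mx w *m B^T).
Proof.
move=> w0; split; first by rewrite !trmx_mul trmxK tr_diag_mx mulmxA.
move=> v; pose u := B^T *m v.
have -> : v^T *m (B *m diag_mx w *m B^T) *m v = u^T *m diag_mx w *m u.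
  by rewrite /u trmx_mul trmxK !mulmxA.
rewrite mxE; apply: sumr_ge0 => j _.
by rewrite mul_mx_diag mxE [u^T _ _]mxE mulrAC mulr_ge0 // -expr2 sqr_ge0.
Qed.

Lemma psd_spectral_mx n (Q : 'M[R]_n) w : (forall j, 0 <= w j) ->
  psd (spectral_mx Q w).
Proof.
by move=> w0; rewrite /spectral_mx -{2}(trmxK Q); apply: psd_congr => j; rewrite mxE.
Qed.

Lemma weighted_gramE m n (A : 'M[R]_(m, n)) (x : 'rV[R]_n) :
  weighted_gram A x = A *m diag_mx x *m A^T.
Proof.
apply/matrixP => i j; rewrite summxE mxE; apply: eq_bigr => l _.
by rewrite mul_mx_diag !mxE big_ord1 !mxE; ring.
Qed.

Lemma psd_weighted_gram m n (A : 'M[R]_(m, n)) (x : 'rV[R]_n) :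
  (forall j, 0 <= x 0 j) -> psd (weighted_gram A x).
Proof. by rewrite weighted_gramE; exact: psd_congr. Qed.

Variables (d k : nat) (lam : R).
Hypotheses (le_kd : (k <= d)%N) (lam_gt0 : 0 < lam).

Lemma convex_minorant (W : 'M[R]_d) c :
  convex_function (@psd R d) (fun X => c - \tr (W *m X)).
Proof.
apply/convex_functionP => t X Y _ _ _.
by rewrite mulmxDr -!scalemxAr mxtraceD !mxtraceZ; lra.
Qed.

(** The trace inequality reduces the claim to eigenvalues. The nonnegative terms from [k] on are
    dropped, and the others are bounded one at a time by [le_inv_quadratic] at [sigma_j + lam]. *)
Lemma minorant_le_Gamma (Q X : 'M[R]_d) (s : nat -> R) :
  Q *m Q^T = 1%:M -> (forall j, 0 <= s j) ->
  (forall i j, (i <= j < d)%N -> s i <= s j) -> psd X ->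
  \sum_(j < k) (2 * s j - lam * s j ^+ 2)
  - \tr (spectral_mx Q (fun j => s j ^+ 2) *m X) <= Gamma k lam X.
Proof.
move=> QQ s0 s_le pX; have sX := pX.1.
have w_le i j : (i <= j < d)%N -> s i ^+ 2 <= s j ^+ 2.
  by move=> /s_le; rewrite ler_pXn2r // nnegrE.
rewrite lerBlDr; apply: le_trans (lerD (lexx _) (le_mxtrace_spectral sX QQ w_le)).
have -> : \sum_(j < d) s j ^+ 2 * (eigs X)`_j =
    \sum_(j < k) s j ^+ 2 * (eigs X)`_j
    + \sum_(k <= j < d) s j ^+ 2 * (eigs X)`_j.
  rewrite -!(big_mkord xpredT (fun j => s j ^+ 2 * (eigs X)`_j)).
  by rewrite -big_cat_nat.
rewrite addrA ler_wpDr //.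
  by apply: sumr_ge0 => j _; rewrite mulr_ge0 ?sqr_ge0 ?eigs_ge0.
rewrite -big_split; apply: ler_sum => j _ /=; rewrite -lerBlDr.
have pos : 0 < (eigs X)`_j + lam by rewrite ltr_wpDl ?eigs_ge0.
apply: le_trans (le_inv_quadratic (s j) pos).
by rewrite mulrDr opprD addrA addrAC [lam * _]mulrC.
Qed.

Lemma minorant_le_envelope (Q X : 'M[R]_d) (s : nat -> R) :
  Q *m Q^T = 1%:M -> (forall j, 0 <= s j) ->
  (forall i j, (i <= j < d)%N -> s i <= s j) -> psd X ->
  \sum_(j < k) (2 * s j - lam * s j ^+ 2)
  - \tr (spectral_mx Q (fun j => s j ^+ 2) *m X)
  <= convex_envelope (@psd R d) (Gamma k lam) X.
Proof.
move=> QQ s0 s_le.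
apply: (le_convex_envelope (g := fun X => _ - \tr (_ *m X))).
  exact: convex_minorant.
by move=> Y; exact: minorant_le_Gamma.
Qed.

End Gamma.

(* Two fractional coordinates can be moved in opposite directions until one of
   them becomes integral, so vertices dominate by induction on their number. *)
Lemma hypersimplex_le (R : realFieldType) m (q : nat) (P : pred 'I_m)
    (F : 'rV[R]_m -> R) (c : R) :
  (forall (t : R) (x y : 'rV[R]_m), 0 <= t <= 1 ->
    (forall j, 0 <= x 0 j) -> (forall j, 0 <= y 0 j) ->
    F (t *: x + (1 - t) *: y) <= t * F x + (1 - t) * F y) ->
  (forall z : 'rV[R]_m, (forall j, (z 0 j == 0) || (z 0 j == 1)) ->
    (forall j, P j -> z 0 j = 1) -> \sum_j z 0 j = q%:R -> F z <= c) ->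
  forall z : 'rV[R]_m, (forall j, 0 <= z 0 j <= 1) ->
    (forall j, P j -> z 0 j = 1) -> \sum_j z 0 j = q%:R -> F z <= c.
Proof.
move=> cF vF z; pose fr (z : 'rV[R]_m) := [pred j | (z 0 j != 0) && (z 0 j != 1)].
have [N] := ubnP #|fr z|; elim: N z => // N IH z /ltnSE leN z01 Pz zq.
have [/existsP[j frj] | /existsPn nfr] := boolP [exists j, fr z j]; last first.
  by apply: vF => // j; have := nfr j; rewrite negb_and !negbK.
(* A fractional coordinate cannot be alone: with all others integral, [q] would lie strictly between
   consecutive integers [r] and [r.+1]. *)
have [l lj frl] : exists2 l, l != j & fr z l.
  apply: contrapT => no_l.
  have nfr l : l != j -> ~~ fr z l.
    by move=> lj; apply/negP => frl; apply: no_l; exists l.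
  have [r rE] : exists r : nat, \sum_(l | l != j) z 0 l = r%:R.
    exists (\sum_(l | l != j) (z 0 l == 1)%R)%N; rewrite natr_sum; apply: eq_bigr => l lj.
    have := nfr l lj; rewrite negb_and !negbK.
    by case/orP=> /eqP->; rewrite ?eqxx // eq_sym oner_eq0.
  move: frj (z01 j) => /andP[n0 n1] /andP[z0 z1].
  have {n0}z0 : 0 < z 0 j by rewrite lt_neqAle eq_sym n0.
  have {n1}z1 : z 0 j < 1 by rewrite lt_neqAle n1.
  move: zq; rewrite (bigD1 j) //= rE => zq.
  have : (r%:R : R) < q%:R by rewrite -zq ltrDr.
  have : (q%:R : R) < r.+1%:R by rewrite -zq -[r.+1]addn1 natrD addrC ltrD2l.
  by rewrite !ltr_nat ltnS leqNgt => /negP.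
have sum_delta i0 : \sum_(i < m) (i == i0)%:R = 1 :> R.
  by rewrite (bigD1 i0) //= eqxx big1 ?addr0 // => i /negbTE ->.
pose y e : 'rV[R]_m := \row_i (z 0 i + e * ((i == j)%:R - (i == l)%:R)).
have yj e : y e 0 j = z 0 j + e by rewrite mxE eqxx (eq_sym j) (negbTE lj) subr0 mulr1.
have yl e : y e 0 l = z 0 l - e by rewrite mxE eqxx (negbTE lj) sub0r mulrN1.
have yi e i : i != j -> i != l -> y e 0 i = z 0 i.
  by move=> /negbTE ij /negbTE il; rewrite mxE ij il subrr mulr0 addr0.
have yF e : 0 <= z 0 j + e <= 1 -> 0 <= z 0 l - e <= 1 ->
    ~~ (fr (y e) j && fr (y e) l) -> (forall i, 0 <= y e 0 i <= 1) /\ F (y e) <= c.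
  move=> ej el nf.
  have y01 i : 0 <= y e 0 i <= 1.
    have [->|ij] := eqVneq i j; first by rewrite yj.
    have [->|il] := eqVneq i l; first by rewrite yl.
    by rewrite yi.
  split=> //; apply: IH => //.
  - apply: leq_trans leN; apply: proper_card; apply/properP; split.
      apply/fintype.subsetP => i; have [->|ij] := eqVneq i j; first by [].
      have [->|il] := eqVneq i l; first by [].
      by rewrite !inE yi.
    by move: nf; rewrite negb_and => /orP[] nf; [exists j | exists l].
  - move=> i Pi; rewrite yi ?Pz //.
      by apply: contraTneq Pi => ->; apply/negP => /Pz/eqP; move: frj => /andP[_ /negbTE ->].
    by apply: contraTneq Pi => ->; apply/negP => /Pz/eqP; move: frl => /andP[_ /negbTE ->].
  - rewrite -zq; under eq_bigr do rewrite mxE.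
    by rewrite big_split /= -mulr_sumr sumrB !sum_delta subrr mulr0 addr0.
have lt01 i : fr z i -> 0 < z 0 i < 1.
  by move=> /andP[n0 n1]; have := z01 i; rewrite !lt_neqAle eq_sym n0 n1.
have /andP[a0 a1] := lt01 j frj; have /andP[b0 b1] := lt01 l frl.
(* The largest steps in the two directions that stay in the cube; after either one, coordinate [j]
   or [l] is 0 or 1. *)
pose e1 := Num.min (1 - z 0 j) (z 0 l); pose e2 := Num.min (z 0 j) (1 - z 0 l).
have e10 : 0 < e1 by rewrite /e1 lt_min subr_gt0 a1.
have e20 : 0 < e2 by rewrite /e2 lt_min subr_gt0 b1 a0.
have [y1 F1] : (forall i, 0 <= y e1 0 i <= 1) /\ F (y e1) <= c.
  apply: yF; rewrite ?yj ?yl /= ?yj ?yl /e1; case: (leP (1 - z 0 j)) => h.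
  - by rewrite addrC subrK; lra.
  - by lra.
  - by lra.
  - by lra.
  - by rewrite (addrC (z 0 j)) subrK eqxx andbF.
  - by rewrite subrr eqxx andbF.
have [y2 F2] : (forall i, 0 <= y (- e2) 0 i <= 1) /\ F (y (- e2)) <= c.
  apply: yF; rewrite ?yj ?yl /= ?yj ?yl /e2; case: (leP (z 0 j)) => h.
  - by lra.
  - by lra.
  - by lra.
  - by lra.
  - by rewrite subrr eqxx.
  - by rewrite opprK (addrC (z 0 l)) subrK eqxx !andbF.
pose t := e2 / (e1 + e2).
have e120 : e1 + e2 != 0 by rewrite gt_eqF // addr_gt0.
have t01 : 0 <= t <= 1.
  apply/andP; split; first by rewrite divr_ge0 ?addr_ge0 // ltW.
  by rewrite ler_pdivrMr ?addr_gt0 // mul1r lerDr ltW.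
have -> : z = t *: y e1 + (1 - t) *: y (- e2).
  apply/rowP => i; rewrite !mxE /t; field; exact: e120.
apply: le_trans (cF _ _ _ t01 _ _) _.
- by move=> i; case/andP: (y1 i).
- by move=> i; case/andP: (y2 i).
have /andP[t0 t1] := t01.
have -> : c = t * c + (1 - t) * c by ring.
by rewrite lerD // ler_wpM2l // subr_ge0.
Qed.

Lemma sum_natr_lt (R : nzSemiRingType) d k : (k <= d)%N ->
  \sum_(j < d) (j < k)%:R = k%:R :> R.
Proof.
move=> kd; rewrite -[in RHS](card_ord k) -sum1_card natr_sum.
rewrite (big_ord_widen d (fun=> 1%:R) kd) [RHS]big_mkcond.
by apply: eq_bigr => j _; case: (j < k)%N.
Qed.

Lemma sorted_mkseq_level (R : realType) n k (b : seq R) i :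
  size b = n -> (k <= n)%N -> (forall i j, (i <= j < n)%N -> b`_j <= b`_i) ->
  (forall j, 0 <= b`_j) -> (i < k)%N -> is_cut k b i ->
  sorted >=%R (mkseq (fun j => level k b i j * (j < k)%:R) n).
Proof.
move=> sz kn b_ge b0 ik ci; apply/(sortedP 0) => j; rewrite size_mkseq => jn.
rewrite !nth_mkseq ?(ltnW jn) //; case: (ltnP j.+1 k) => jk.
  by rewrite (ltnW jk) !mulr1; apply: (level_nonincr kn b_ge ik ci).
by rewrite mulr0; apply: mulr_ge0; rewrite ?ler0n ?level_ge0.
Qed.

(** From [i] on all levels agree, so moving the ones of [z] among these positions only permutes the
    list. *)
Lemma perm_level (R : realType) n k (b : seq R) i (z : nat -> R) :
  (k <= n)%N -> (i < k)%N -> (forall j, (j < n)%N -> (z j == 0) || (z j == 1)) ->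
  (forall j, (j < i)%N -> z j = 1) -> \sum_(j < n) z j = k%:R ->
  perm_eq (mkseq (fun j => level k b i j * (j < k)%:R) n)
          (mkseq (fun j => level k b i j * z j) n).
Proof.
move=> kn ik z01 zi zk; set u := level k b i; apply/seq.permP => a.
have u_i j : (i <= j)%N -> u j = u i by move=> ij; rewrite /u /level !ltnNge ij leqnn.
(* The number of entries satisfying [a] depends on [y] only through its sum [k], hence agrees for
   [z] and for the indicator of the first [k] indices. *)
have countE (y : nat -> R) : (forall j, (j < n)%N -> (y j == 0) || (y j == 1)) ->
    (forall j, (j < i)%N -> y j = 1) -> \sum_(j < n) y j = k%:R ->
    (count a (mkseq (fun j => u j * y j) n))%:R =
    \sum_(j < n) ((a 0)%:R + (j < i)%:R * ((a (u j))%:R - (a (u i))%:R))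
    + k%:R * ((a (u i))%:R - (a 0)%:R) :> R.
  move=> y01 yi yk; rewrite -sum1_count big_map natr_sum -yk mulr_suml -big_split.
  rewrite big_mkcond -{1}(subn0 n) -/(index_iota 0 n) big_mkord.
  apply: eq_bigr => j _ /=; case: (ltnP j i) => ji.
    by rewrite (yi _ ji) mulr1; case: (a _); case: (a _); case: (a _) => /=; ring.
  rewrite (u_i _ ji); have /orP[/eqP->|/eqP->] := y01 _ (ltn_ord j).
    by rewrite mulr0; case: (a 0); case: (a _) => /=; ring.
  by rewrite mulr1; case: (a 0); case: (a _) => /=; ring.
apply/eqP; rewrite -(eqr_nat R); apply/eqP.
rewrite (countE z) // countE ?sum_natr_lt //.
  by move=> j _; case: (j < k)%N; rewrite ?eqxx ?orbT.
by move=> j ji; rewrite (ltn_trans ji ik).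
Qed.

(** * Upper bound on the envelope from the vertices of a hypersimplex *)

Section EnvelopeUpper.
Variables (R : realType) (d k : nat) (lam : R).
Hypotheses (le_kd : (k <= d)%N) (lam_gt0 : 0 < lam).

Lemma Gamma_level (Q : 'M[R]_d) (b : seq R) i (z : nat -> R) :
  Q *m Q^T = 1%:M -> size b = d ->
  (forall i j, (i <= j < d)%N -> b`_j <= b`_i) ->
  (forall j, 0 <= b`_j) -> (i < k)%N -> is_cut k b i ->
  (forall j, (j < d)%N -> (z j == 0) || (z j == 1)) ->
  (forall j, (j < i)%N -> z j = 1) -> \sum_(j < d) z j = k%:R ->
  Gamma k lam (spectral_mx Q (fun j => level k b i j * z j)) =
  \sum_(j < k) (level k b i j + lam)^-1.
Proof.
move=> QQ sz b_ge b0 ik ci z01 zi zk; rewrite /Gamma.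
rewrite (eigs_spectral_mx QQ (sorted_mkseq_level sz le_kd b_ge b0 ik ci)).
  apply: eq_bigr => j _.
  by rewrite nth_mkseq ?(leq_trans (ltn_ord j) le_kd) // ltn_ord mulr1.
exact: perm_level.
Qed.

(** [X] is [V z] for some [z] in the hypersimplex, [V] is linear, and at each vertex a convex
    underestimator is at most [Gamma], whose value there is the right-hand side by [Gamma_level]. *)
Lemma envelope_le_level (X : 'M[R]_d) i : psd X -> (i < k)%N ->
  is_cut k (eigs X) i ->
  convex_envelope (@psd R d) (Gamma k lam) X <=
  \sum_(j < k) (level k (eigs X) i j + lam)^-1.
Proof.
move=> pX ik ci; have [sX _] := pX; have [Q [QQ XE sz _]] := eigs_spectral sX.
set b := eigs X in XE sz ci *; set u := level k b i.
have b_ge j l : (j <= l < d)%N -> b`_l <= b`_j by exact: eigs_nonincr.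
have b0 j : 0 <= b`_j by exact: eigs_ge0.
have u0 j : 0 <= u j by exact: level_ge0.
have b_le j : (i <= j < d)%N -> b`_j <= u i.
  by move=> /b_ge /le_trans -> //; rewrite /u /level ltnn; case/andP: ci.
have ui j : (i <= j)%N -> u j = u i.
  by move=> ij; rewrite /u /level !ltnNge ij leqnn.
apply: (convex_envelope_le (g0 := fun=> 0)).
- by apply/convex_functionP => t x y _ _ _; rewrite !mulr0 addr0.
- move=> Y pY; apply: sumr_ge0 => j _.
  by rewrite invr_ge0 addr_ge0 ?eigs_ge0 // ltW.
move=> g /convex_functionP cg gG.
pose ext (z : 'rV[R]_d) j := if insub j is Some l then z 0 l else 0.
have extE z (j : 'I_d) : ext z j = z 0 j by rewrite /ext valK.
pose V z := spectral_mx Q (fun j => u j * ext z j).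
have pV (z : 'rV[R]_d) : (forall j, 0 <= z 0 j) -> psd (V z).
  move=> z0; apply: psd_spectral_mx => j; rewrite mulr_ge0 // /ext.
  by case: insubP.
(* Chosen so that [u j * z 0 j] is the eigenvalue [b_j]. If [u i = 0] the tail eigenvalues vanish
   and any tail of [z] reproduces [X]; the indicator of [j < k] gives the required sum. *)
pose z : 'rV[R]_d := \row_j
  if (j < i)%N then 1 else if u i == 0 then (j < k)%:R else b`_j / u i.
have zE (j : 'I_d) : u j * z 0 j = b`_j.
  rewrite mxE; case: ltnP => ij; first by rewrite mulr1 /u /level ij.
  rewrite ui //; case: eqVneq => [u_eq0|u_neq0]; last by field.
  rewrite u_eq0 mul0r; apply/le_anti; rewrite b0 /=.
  by have := b_le j; rewrite ij ltn_ord u_eq0; exact.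
have -> : X = V z.
  apply/matrixP => r s; rewrite [in LHS]XE !spectral_mxE; apply: eq_bigr => j _.
  by rewrite extE zE.
apply: (hypersimplex_le (q := k) (P := [pred j : 'I_d | (j < i)%N])
  (F := fun z => g (V z))).
- move=> t x y t01 x0 y0; have := cg _ _ _ t01 (pV _ x0) (pV _ y0).
  congr (g _ <= _); apply/matrixP => r s; rewrite mxE [X in X + _]mxE.
  rewrite [X in _ + X]mxE !spectral_mxE !mulr_sumr -big_split.
  by apply: eq_bigr => j _; rewrite !extE !mxE /=; ring.
- move=> y y01 yi yk; rewrite -(Gamma_level QQ sz b_ge b0 ik ci (z := ext y)).
  + by apply/gG/pV => j; have /orP[/eqP->|/eqP->] := y01 j; rewrite ?lexx ?ler01.
  + by move=> j jd; rewrite -[j]/(val (Ordinal jd)) extE.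
  + move=> j ji; have jd : (j < d)%N by rewrite (ltn_trans ji) // (leq_trans ik).
    by rewrite -[j]/(val (Ordinal jd)) extE yi.
  + by rewrite -yk; apply: eq_bigr => j _; rewrite extE.
- move=> j; rewrite mxE; case: ltnP => ij; first by rewrite ler01 lexx.
  case: eqVneq => u_eq0; first by case: (j < k)%N; rewrite ?lexx ?ler01.
  have u_gt0 : 0 < u i by rewrite lt_neqAle eq_sym u_eq0 u0.
  by rewrite divr_ge0 //= ler_pdivrMr // mul1r b_le // ij ltn_ord.
- by move=> j /= ji; rewrite mxE ji.
have [u_eq0|u_neq0] := eqVneq (u i) 0.
  rewrite -(sum_natr_lt _ le_kd); apply: eq_bigr => j _; rewrite mxE u_eq0 eqxx.
  by case: ltnP => // ji; rewrite (ltn_trans ji ik).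
pose S := \sum_(i <= j < d) b`_j.
have uE : u i = S / (k - i)%:R by rewrite /u /level ltnn sz.
have S0 : S != 0 by apply: contra u_neq0 => /eqP S0; rewrite uE S0 mul0r.
transitivity (\sum_(0 <= j < d) if (j < i)%N then 1 else b`_j / u i).
  by rewrite big_mkord; apply: eq_bigr => j _; rewrite mxE (negbTE u_neq0).
have le_id : (i <= d)%N by rewrite (leq_trans (ltnW ik)).
rewrite (big_cat_nat (leq0n i) le_id) /=.
have -> : \sum_(i <= j < d) (if (j < i)%N then 1 else b`_j / u i) = S / u i.
  by rewrite mulr_suml; apply: eq_big_nat => j /andP[ij _]; rewrite ltnNge ij.
rewrite big_mkord; under eq_bigr do rewrite ltn_ord.
rewrite sumr_const card_ord.
rewrite uE invf_div mulrCA mulfV // mulr1.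
by rewrite -natrD subnKC // ltnW.
Qed.

End EnvelopeUpper.

(** * Spectra of the two weighted Gram matrices *)

(** Sylvester's identity: the determinant of [M] is evaluated by two block eliminations, one on the
    right and one on the left. *)
Lemma char_poly_mulmxC (R : comNzRingType) m n (A : 'M[R]_(m, n)) (B : 'M[R]_(n, m)) :
  'X^n * char_poly (A *m B) = 'X^m * char_poly (B *m A).
Proof.
pose A' := map_mx polyC A; pose B' := map_mx polyC B.
pose M := block_mx ('X%:M : 'M[{poly R}]_m) A' B' (1%:M : 'M[{poly R}]_n).
have E1 : \det M = char_poly (A *m B).
  have : M *m block_mx 1%:M 0 (- B') 1%:M = block_mx ('X%:M - A' *m B') A' 0 1%:M.
    rewrite mulmx_block !mulmx0 !mulmx1 mul1mx mulmxN addrN !add0r.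
    by [].
  move=> /(congr1 determinant); rewrite det_mulmx det_lblock det_ublock !det1 !mulr1.
  by rewrite /char_poly /char_poly_mx map_mxM.
have : block_mx 1%:M 0 (- B') 'X%:M *m M =
    block_mx 'X%:M A' 0 ('X%:M - B' *m A').
  rewrite mulmx_block !mul0mx !mul1mx !mulmx1 !addr0 mulNmx scalar_mxC addNr.
  by rewrite mulNmx addrC.
move=> /(congr1 determinant); rewrite det_mulmx det_lblock det_ublock det1 mul1r.
by rewrite E1 !det_scalar => ->; rewrite /char_poly /char_poly_mx map_mxM.
Qed.

Section Key.
Variable R : realType.

Lemma char_poly_eigs n (X : 'M[R]_n) : X^T = X ->
  char_poly X = \prod_(b <- eigs X) ('X - b%:P).
Proof.
move=> /eigs_spectral[Q [QQ XE sz _]]; rewrite [in LHS]XE char_poly_spectral //.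
by rewrite -[X in mkseq _ X]sz mkseq_nth.
Qed.

Lemma psd_gram m n (G : 'M[R]_(m, n)) : psd (G *m G^T).
Proof.
have := @psd_congr R m n G (const_mx 1); rewrite diag_const_mx mulmx1.
by apply=> j; rewrite mxE ler01.
Qed.

(** The larger product has the same spectrum padded with [n - m] zeros, which the default 0 of [nth]
    hides. *)
Lemma eigs_gramC m n (G : 'M[R]_(m, n)) j : (m <= n)%N ->
  (eigs (G^T *m G))`_j = (eigs (G *m G^T))`_j.
Proof.
move=> mn; set s := eigs (G *m G^T).
have pG := psd_gram G; have [_ [_ _ sz _]] := eigs_spectral pG.1.
have snth l : (s ++ nseq (n - m) 0)`_l = s`_l.
  rewrite nth_cat; case: ltnP => // sl; rewrite nth_nseq if_same.
  by rewrite nth_default.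
suff -> : eigs (G^T *m G) = s ++ nseq (n - m) 0 by rewrite snth.
apply: eigs_unique.
  apply/(sortedP 0) => l; rewrite size_cat size_nseq sz subnKC // => ln /=.
  rewrite !snth; case: (ltnP l.+1 m) => lm; first by rewrite eigs_nonincr ?pG.1 // leqnSn.
  by rewrite (nth_default _ (_ : size s <= l.+1)%N) ?sz // eigs_ge0.
have Xm0 : ('X^m : {poly R}) != 0 by rewrite expf_neq0 // polyX_eq0.
apply: (mulfI Xm0); rewrite -char_poly_mulmxC (char_poly_eigs pG.1) -/s.
rewrite big_cat /= mulrCA [LHS]mulrC; congr (_ * _).
rewrite -(subnKC mn) exprD addKn; congr (_ * _).
by rewrite big_nseq subr0 iter_mulr_1.
Qed.

Lemma mxtrace_spectral_eigs n (P X : 'M[R]_n) v : P *m P^T = 1%:M ->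
  X = spectral_mx P (nth 0 (eigs X)) ->
  \tr (spectral_mx P v *m X) = \sum_(j < n) v j * (eigs X)`_j.
Proof.
by move=> PP XP; rewrite [in LHS]XP mul_spectral_mx // mxtrace_spectral.
Qed.

Variables (d n : nat) (A : 'M[R]_(d, n)) (lam : R) (H : 'M[R]_n) (x : 'rV[R]_n).
Hypotheses (le_dn : (d <= n)%N) (lam_gt0 : 0 < lam).
Hypothesis HH : A^T *m A + lam%:M = H^T *m H.
Hypothesis x01 : forall j, 0 <= x 0 j <= 1.

(** [E] is the square root of [diag_mx x]. The product [Z] has the spectrum of [weighted_gram H x]
    and, unlike it, splits through [HH] into [G^T *m G] plus a diagonal matrix. *)
Let E := diag_mx (\row_j Num.sqrt (x 0 j)).
Let G := A *m E.
Let Z := (H *m E)^T *m (H *m E).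

Let EE : E *m E = diag_mx x.
Proof.
rewrite mulmx_diag; congr diag_mx; apply/rowP => j; rewrite !mxE -expr2 sqr_sqrtr //.
by case/andP: (x01 j).
Qed.

Let gramE m (B : 'M[R]_(m, n)) : weighted_gram B x = (B *m E) *m (B *m E)^T.
Proof. by rewrite weighted_gramE trmx_mul tr_diag_mx mulmxA -(mulmxA B E) EE. Qed.

Let ZE : Z = G^T *m G + lam *: diag_mx x.
Proof.
rewrite /Z /G !trmx_mul tr_diag_mx !mulmxA -(mulmxA E) -HH mulmxDr mulmxDl.
by rewrite -!mulmxA mul_scalar_mx -scalemxAr EE !mulmxA.
Qed.

Let sZ : Z^T = Z.
Proof. by rewrite /Z trmx_mul trmxK. Qed.

Lemma sum_eigs_gram :
  \sum_(j < n) (eigs (weighted_gram H x))`_j =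
  \sum_(j < d) (eigs (weighted_gram A x))`_j + lam * \sum_(j < n) x 0 j.
Proof.
have x0 j : 0 <= x 0 j by case/andP: (x01 j).
rewrite -!mxtrace_eigs ?(psd_weighted_gram _ x0).1 // !gramE [LHS]mxtrace_mulC.
by rewrite -/Z ZE mxtraceD mxtraceZ mxtrace_diag [in RHS]mxtrace_mulC.
Qed.

(** The left side is the trace of [Z] against a matrix diagonal in its own eigenbasis. The part
    [G^T *m G] obeys the trace inequality, and [x <= 1] bounds the diagonal part. *)
Lemma eigs_gram_majorization (v : nat -> R) : (forall j, 0 <= v j) ->
  (forall i j, (i <= j < n)%N -> v j <= v i) ->
  \sum_(j < n) v j * (eigs (weighted_gram H x))`_j <=
  \sum_(j < d) v j * (eigs (weighted_gram A x))`_j + lam * \sum_(j < n) v j.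
Proof.
move=> v0 v_ge; have [P [PP ZP szZ _]] := eigs_spectral sZ.
have -> : \sum_(j < n) v j * (eigs (weighted_gram H x))`_j =
    \tr (spectral_mx P v *m Z).
  rewrite (mxtrace_spectral_eigs v PP ZP); apply: eq_bigr => j _.
  by rewrite (gramE H) -(eigs_gramC (H *m E) j (leqnn n)).
rewrite ZE mulmxDr mxtraceD -scalemxAr mxtraceZ; apply: lerD.
  have sG : (G^T *m G)^T = G^T *m G by rewrite trmx_mul trmxK.
  (* The weights [- v] are nondecreasing, which turns the lower trace bound into an upper one. *)
  have := @le_mxtrace_spectral R n _ P (fun j => - v j) sG PP.
  have -> : spectral_mx P (fun j => - v j) = - spectral_mx P v.
    apply/matrixP => i j; rewrite [RHS]mxE !spectral_mxE -sumrN.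
    by apply: eq_bigr => l _; rewrite mulNr.
  under eq_bigr do rewrite mulNr.
  rewrite sumrN mulNmx raddfN /= lerN2 => le_v.
  apply: le_trans (le_v _) _; first by move=> i j ij; rewrite lerN2 v_ge.
  rewrite [leRHS](big_ord_widen n (fun j => v j * (eigs (weighted_gram A x))`_j) le_dn).
  rewrite [leRHS]big_mkcond; apply: ler_sum => j _ /=.
  rewrite eigs_gramC // -gramE; case: ltnP => // dj.
  rewrite nth_default ?mulr0 //.
  have x0 l : 0 <= x 0 l by case/andP: (x01 l).
  by have [_ [_ _ -> _]] := eigs_spectral (psd_weighted_gram A x0).1.
apply: ler_wpM2l; first exact: ltW.
rewrite -(mxtrace_spectral v PP).
rewrite /mxtrace; apply: ler_sum => j _; rewrite mul_mx_diag mxE ler_piMr //.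
  rewrite spectral_mxE; apply: sumr_ge0 => l _.
  by rewrite mulr_ge0 // -expr2 sqr_ge0.
by case/andP: (x01 j).
Qed.

End Key.

(** * Attainment of minima *)

Lemma seq_argmin (T : eqType) (R : realDomainType) (f : T -> R) x0 (s : seq T) :
  exists2 y, y \in x0 :: s & forall z, z \in x0 :: s -> f y <= f z.
Proof.
elim: s x0 => [|x1 s IH] x0.
  by exists x0; rewrite ?mem_head // => z; rewrite inE => /eqP->.
have [y ys y_min] := IH x1; have [le_y0|/ltW le_0y] := leP (f y) (f x0).
  exists y; first by rewrite inE ys orbT.
  by move=> z; rewrite inE => /orP[/eqP->//|/y_min].
exists x0; first by rewrite mem_head.
by move=> z; rewrite inE => /orP[/eqP->//|/y_min]; exact: le_trans.
Qed.

(* If [f] had no minimum on [K], the open sets where some minorant exceeds [f y]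
   would cover [K] as [y] ranges over [K]; a finite subcover contradicts the
   choice of its index with the smallest value of [f]. *)
Lemma compact_min_of_minorants (R : realType) (T : ptopologicalType) (K : set T)
    (f : T -> R) : compact K -> K !=set0 ->
  (forall x, K x -> exists g : T -> R, [/\ continuous g, f x <= g x &
     forall y, K y -> g y <= f y]) ->
  exists2 x, K x & forall y, K y -> f x <= f y.
Proof.
rewrite compact_cover => cK [x0 Kx0] supp; apply: contrapT => no_min.
pose U y := [set z | exists g : T -> R,
  [/\ continuous g, forall w, K w -> g w <= f w & f y < g z]].
have [||D DK cov] := cK T K U.
- move=> y _.
  have -> : U y = \bigcup_(g in [set g : T -> R |
      continuous g /\ forall w, K w -> g w <= f w]) (g @^-1` [set r | f y < r]).
    apply/seteqP; split => z /=.
      by case=> g [? ? ?]; exists g.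
    by case=> g [? ?] ?; exists g.
  by apply: bigcup_open => g [cg _]; apply: open_comp => // *; exact: cg.
- move=> x Kx; have [g [cg fg gf]] := supp x Kx.
  have [y Ky fy] : exists2 y, K y & f y < f x.
    apply: contrapT => no_y; apply: no_min; exists x => // y Ky.
    by rewrite leNgt; apply/negP => fy; apply: no_y; exists y.
  by exists y => //; exists g; split=> //; exact: lt_le_trans fg.
(* A point of [K] makes the subcover nonempty and seeds [seq_argmin]. *)
have [y1 Dy1 _] := cov _ Kx0.
have [y yD y_min] := seq_argmin f y1 (enum_fset D).
have yD' : y \in D by move: yD; rewrite inE => /orP[/eqP->|].
have Ky : K y by apply/set_mem/DK.
have [z Dz [g [_ gf]]] := cov _ Ky.
apply/negP; rewrite -leNgt; apply: le_trans (gf _ Ky) _.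
by apply: y_min; rewrite inE; apply/orP; right.
Qed.

(** * The feasible set and minorants affine in [x] *)

Section Feasible.
Variables (R : realType) (n k : nat).
Hypothesis le_kn : (k <= n)%N.

Lemma feasible_neq0 : @feasible R n k !=set0.
Proof.
exists (\row_j (j < k)%:R); split=> [j|].
  by rewrite mxE; case: (j < k)%N; rewrite ?lexx ?ler01.
by rewrite -(sum_natr_lt R le_kn); apply: eq_bigr => j _; rewrite mxE.
Qed.

Lemma compact_feasible : compact (@feasible R n k).
Proof.
have -> : @feasible R n k =
    [set x : 'rV[R]_n | forall i, `[0, 1]%classic (x ord0 i)]
    `&` (fun x : 'rV[R]_n => \sum_(i < n) x 0 i) @^-1` [set k%:R].
  by apply/seteqP; split=> x [x01 xk]; split=> // i; have := x01 i;
    rewrite /= in_itv.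
apply: compact_closedI.
  apply: (@rV_compact R n (fun=> `[0, 1]%classic)) => i.
  exact: segment_compact.
apply: closed_comp; last exact: closed_eq.
move=> x _; apply: continuous_big; first exact: add_continuous.
by move=> i _; exact: coord_continuous.
Qed.

(** The dimension [m] is left free because the minorants for [objM] use matrices of size [n], the
    others of size [d]. *)
Lemma feasible_min (f : 'rV[R]_n -> R) :
  (forall x, feasible k x -> exists m (B : 'M[R]_(m, n)) (W : 'M[R]_m) c,
    f x <= c - \tr (W *m weighted_gram B x) /\
    forall y, feasible k y -> c - \tr (W *m weighted_gram B y) <= f y) ->
  exists2 x, feasible k x & forall y, feasible k y -> f x <= f y.
Proof.
move=> supp; apply: compact_min_of_minorants.
- exact: compact_feasible.
- exact: feasible_neq0.
move=> x /supp[m [B [W [c [fx fy]]]]].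
exists (fun y => c - \tr (W *m weighted_gram B y)); split=> //.
have -> : (fun y => c - \tr (W *m weighted_gram B y)) =
  (fun y => c - \sum_(j < n) y 0 j * \tr (W *m (col j B *m (col j B)^T))).
  apply/funext => y; rewrite /weighted_gram mulmx_sumr; congr (_ - _).
  rewrite (raddf_sum mxtrace) /=.
  by apply: eq_bigr => j _; rewrite -scalemxAr mxtraceZ.
have cS : continuous (fun y : 'rV[R]_n =>
    \sum_(j < n) y 0 j * \tr (W *m (col j B *m (col j B)^T))).
  apply: continuous_big; first exact: add_continuous.
  move=> j _ z; apply: (@continuousM R 'rV[R]_n (fun y => y 0 j) (fun=> _)).
    exact: coord_continuous.
  exact: cst_continuous.
move=> y; apply: (@continuousB R R 'rV[R]_n (fun=> c)); last exact: cS.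
exact: cst_continuous.
Qed.

Lemma is_min_of_minimizer (f : 'rV[R]_n -> R) x : feasible k x ->
  (forall y, feasible k y -> f x <= f y) -> is_min (@feasible R n k) f (f x).
Proof.
by move=> fx f_min; split; [exists x | move=> _ [y fy <-]; exact: f_min].
Qed.

End Feasible.

(** * Comparison of the three objectives *)

Section Objectives.
Variables (R : realType) (d n k : nat) (A : 'M[R]_(d, n)) (lam : R) (H : 'M[R]_n).
Hypotheses (d_gt0 : (0 < d)%N) (le_dn : (d <= n)%N).
Hypotheses (k_gt0 : (0 < k)%N) (le_kn : (k <= n)%N) (lam_gt0 : 0 < lam).
Hypothesis HH : A^T *m A + lam%:M = H^T *m H.

Let kt := minn k d.
Let kt_gt0 : (0 < kt)%N. Proof. by rewrite leq_min k_gt0. Qed.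
Let le_ktd : (kt <= d)%N. Proof. exact: geq_minr. Qed.
Let le_ktk : (kt <= k)%N. Proof. exact: geq_minl. Qed.

Let psd_feasible m (B : 'M[R]_(m, n)) x : feasible k x -> psd (weighted_gram B x).
Proof. by move=> [x01 _]; apply: psd_weighted_gram => j; case/andP: (x01 j). Qed.

(** Each additional term is at most [lam^-1]; this is what the constants [(d - kt) / lam] and
    [(d - k) / lam] in the objectives compensate. *)
Let sum_quadratic_le (s : nat -> R) a b : (a <= b)%N ->
  \sum_(j < b) (2 * s j - lam * s j ^+ 2) <=
  \sum_(j < a) (2 * s j - lam * s j ^+ 2) + (b%:R - a%:R) / lam.
Proof.
move=> ab; rewrite -!(big_mkord xpredT (fun j => 2 * s j - lam * s j ^+ 2)).
rewrite (big_cat_nat (leq0n a) ab) lerD2l /= -natrB // mulrC mulr_natr.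
rewrite -[leRHS]iter_addr_0 -big_const_nat; apply: ler_sum => j _.
by have := le_inv_quadratic (s j) lam_gt0; rewrite [lam * _]mulrC.
Qed.

Lemma mxtrace_invmx_spectral (P X : 'M[R]_d) : P *m P^T = 1%:M -> psd X ->
  X = spectral_mx P (nth 0 (eigs X)) ->
  \tr (invmx (X + lam%:M)) = \sum_(j < d) ((eigs X)`_j + lam)^-1.
Proof.
move=> PP pX XP; have pos j : 0 < (eigs X)`_j + lam by rewrite ltr_wpDl ?eigs_ge0.
have cE c : spectral_mx P (fun=> c) = c%:M.
  rewrite /spectral_mx (_ : \row_(j < d) c = const_mx c).
    by rewrite diag_const_mx scalar_mxC -mulmxA (mulmx1C PP) mulmx1.
  by apply/rowP => j; rewrite !mxE.
have E : X + lam%:M = spectral_mx P (fun j => (eigs X)`_j + lam).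
  rewrite -cE {1}XP; apply/matrixP => i j; rewrite mxE !spectral_mxE -big_split.
  by apply: eq_bigr => l _ /=; ring.
have inv : (X + lam%:M) *m spectral_mx P (fun j => ((eigs X)`_j + lam)^-1) = 1%:M.
  rewrite E mul_spectral_mx // -cE; congr spectral_mx; apply/funext => j.
  by rewrite mulfV // gt_eqF.
have -> : invmx (X + lam%:M) = spectral_mx P (fun j => ((eigs X)`_j + lam)^-1).
  by rewrite -[RHS](mulKmx (mulmx1_unit inv).1) inv mulmx1.
exact: mxtrace_spectral.
Qed.

Lemma objC_Gamma x : feasible k x -> objC A lam x = Gamma d lam (weighted_gram A x).
Proof.
move=> /(psd_feasible A) pX; have [P [PP XP _ _]] := eigs_spectral pX.1.
by rewrite /objC (mxtrace_invmx_spectral PP pX XP).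
Qed.

Let resolvent (X : 'M[R]_d) j := ((eigs X)`_j + lam)^-1.

Let resolvent_ge0 X j : psd X -> 0 <= resolvent X j.
Proof. by move=> pX; rewrite invr_ge0 addr_ge0 ?eigs_ge0 // ltW. Qed.

Let resolvent_le X i j : psd X -> (i <= j < d)%N -> resolvent X i <= resolvent X j.
Proof.
move=> pX ij; rewrite lef_pV2 ?posrE ?ltr_wpDl ?eigs_ge0 // lerD2r.
exact: eigs_nonincr pX.1 ij.
Qed.

Let resolvent_dual X : psd X ->
  \sum_(j < d) (2 * resolvent X j - lam * resolvent X j ^+ 2)
  - \sum_(j < d) resolvent X j ^+ 2 * (eigs X)`_j = \sum_(j < d) resolvent X j.
Proof.
move=> pX; rewrite -sumrB; apply: eq_bigr => j _.
by rewrite /resolvent; field; rewrite gt_eqF // ltr_wpDl ?eigs_ge0.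
Qed.

Lemma objC_min : exists2 x, feasible k x &
  forall y, feasible k y -> objC A lam x <= objC A lam y.
Proof.
apply: feasible_min => // x fx; set X := weighted_gram A x.
have pX : psd X by exact: psd_feasible.
have [P [PP XP _ _]] := eigs_spectral pX.1.
exists d, A, (spectral_mx P (fun j => resolvent X j ^+ 2)),
  (\sum_(j < d) (2 * resolvent X j - lam * resolvent X j ^+ 2)); split.
  by rewrite (mxtrace_spectral_eigs _ PP XP) resolvent_dual // objC_Gamma.
move=> y fy; rewrite objC_Gamma //; apply: minorant_le_Gamma => //.
- by move=> j; exact: resolvent_ge0.
- by move=> i j; exact: resolvent_le.
exact: psd_feasible.
Qed.

Lemma objC_le_objN x : feasible k x -> objC A lam x <= objN k A lam x.
Proof.
move=> fx; set X := weighted_gram A x.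
have pX : psd X by exact: psd_feasible.
have [P [PP XP _ _]] := eigs_spectral pX.1.
have := minorant_le_envelope le_ktd lam_gt0 PP (fun j => resolvent_ge0 j pX)
  (fun i j => @resolvent_le X i j pX) pX.
rewrite (mxtrace_spectral_eigs _ PP XP) => env.
rewrite objC_Gamma // /Gamma -/X -[leLHS](resolvent_dual pX) /objN -/kt -/X.
have := sum_quadratic_le (resolvent X) le_ktd; lra.
Qed.

Lemma objN_le_objC x : (d <= k)%N -> feasible k x -> objN k A lam x <= objC A lam x.
Proof.
move=> dk fx; rewrite objC_Gamma // /objN (minn_idPr dk) subrr mul0r addr0.
have pX := psd_feasible A fx.
apply: (convex_envelope_le (g0 := fun=> 0)).
- by apply/convex_functionP => t X Y _ _ _; rewrite !mulr0 addr0.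
- move=> Y pY; apply: sumr_ge0 => j _.
  by rewrite invr_ge0 addr_ge0 ?eigs_ge0 // ltW.
- by move=> g _; exact.
Qed.

(** The upper bound [envelope_le_level] and the dual identity [level_dual_eq] meet at [X], so the
    minorant is exact there. *)
Lemma objN_min : exists2 x, feasible k x &
  forall y, feasible k y -> objN k A lam x <= objN k A lam y.
Proof.
apply: feasible_min => // x fx; set X := weighted_gram A x.
have pX : psd X by exact: psd_feasible.
have [P [PP XP sz _]] := eigs_spectral pX.1.
have b_ge i j : (i <= j < d)%N -> (eigs X)`_j <= (eigs X)`_i.
  exact: eigs_nonincr pX.1.
have b_ge0 j : 0 <= (eigs X)`_j by exact: eigs_ge0.
have [i ci] := cut_exists sz le_ktd b_ge0 kt_gt0.
pose s j := (level kt (eigs X) i j + lam)^-1.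
have pos j : 0 < level kt (eigs X) i j + lam by rewrite ltr_wpDl ?level_ge0.
have s0 j : 0 <= s j by rewrite invr_ge0 ltW.
have s_le j l : (j <= l < d)%N -> s j <= s l.
  move=> /andP[jl _]; rewrite lef_pV2 ?posrE // lerD2r.
  exact: (level_nonincr le_ktd b_ge (ltn_ord i) ci).
exists d, A, (spectral_mx P (fun j => s j ^+ 2)),
  (\sum_(j < kt) (2 * s j - lam * s j ^+ 2) + (d%:R - kt%:R) / lam); split.
  rewrite (mxtrace_spectral_eigs _ PP XP) addrAC lerD2r.
  apply: le_trans (envelope_le_level le_ktd lam_gt0 pX (ltn_ord i) ci) _.
  by rewrite -(level_dual_eq sz le_ktd (ltn_ord i) (fun j _ => pos j)).
move=> y fy; rewrite addrAC lerD2r; apply: minorant_le_envelope => //.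
exact: psd_feasible.
Qed.

(** Majorization with the indicator of the first [i] indices bounds the head of the spectrum by the
    trace of [weighted_gram A x] plus [lam * i]. The full trace exceeds the former by [lam * k], so
    the tail sum is at least [lam * (k - i)]. *)
Lemma level_gram_gt0 x i : feasible k x -> (i < k)%N ->
  is_cut k (eigs (weighted_gram H x)) i ->
  forall j, 0 < level k (eigs (weighted_gram H x)) i j.
Proof.
move=> fx ik ci; have pY := psd_feasible H fx; set b := eigs _ in ci *.
have [_ [_ _ sz _]] := eigs_spectral pY.1; rewrite -/b in sz.
have b_ge j l : (j <= l < n)%N -> b`_l <= b`_j by exact: eigs_nonincr pY.1.
have avg_gt0 : 0 < level k b i i.
  rewrite /level ltnn divr_gt0 ?ltr0n ?subn_gt0 // sz.
  have := @eigs_gram_majorization _ _ _ A lam H x le_dn lam_gt0 HH fx.1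
    (fun j => (j < i)%:R) (fun j => ler0n _ _).
  have v_le j l : (j <= l < n)%N -> (l < i)%:R <= (j < i)%:R :> R.
    move=> /andP[jl _]; case: (ltnP l i) => // li.
    by rewrite (leq_ltn_trans jl li).
  move=> /(_ v_le); rewrite sum_natr_lt ?(leq_trans (ltnW ik)) // -/b => maj.
  have := sum_eigs_gram HH fx.1; rewrite fx.2 -/b => trE.
  rewrite big_geq_mkord big_mkcond /=.
  have -> : \sum_(j < n) (if (i <= j)%N then b`_j else 0) =
      \sum_(j < n) b`_j - \sum_(j < n) (j < i)%:R * b`_j.
    rewrite -sumrB; apply: eq_bigr => j _.
    by case: ltnP; rewrite ?mul1r ?subrr // mul0r subr0.
  have le_trX : \sum_(j < d) (j < i)%:R * (eigs (weighted_gram A x))`_j <=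
      \sum_(j < d) (eigs (weighted_gram A x))`_j.
    apply: ler_sum => j _; have := eigs_ge0 j (psd_feasible A fx).
    by case: (j < i)%N; rewrite ?mul1r ?mul0r.
  have lt_ik : lam * i%:R < lam * k%:R by rewrite ltr_pM2l // ltr_nat.
  by rewrite trE; lra.
move=> j; have [ij|ji] := ltnP i j.
  by move: avg_gt0; rewrite /level ltnn ltnNge (ltnW ij).
by apply: lt_le_trans avg_gt0 _; apply: (level_nonincr le_kn b_ge ik ci).
Qed.

Lemma Phi_dual_le x (s : nat -> R) : feasible k x -> (forall j, 0 <= s j) ->
  (forall j l, (j <= l < n)%N -> s j <= s l) ->
  \sum_(j < k) 2 * s j
  - \sum_(j < n) s j ^+ 2 * (eigs (weighted_gram H x))`_j
  <= Phi k (weighted_gram H x).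
Proof.
move=> fx s0 s_le; have pY := psd_feasible H fx.
have [_ [_ _ sz _]] := eigs_spectral pY.1.
have k0n : (0 < k <= n)%N by rewrite k_gt0.
have [i [ik ci ->]] := Phi_level k0n pY.
have pos j : (j < k)%N -> 0 < level k (eigs (weighted_gram H x)) i j + 0.
  by move=> _; rewrite addr0; exact: level_gram_gt0.
have := level_dual_le sz le_kn (fun j l => @eigs_nonincr _ _ _ j l pY.1)
  (fun j => eigs_ge0 j pY) ik ci pos s0 s_le.
under eq_bigr do rewrite mul0r subr0.
by under [leRHS]eq_bigr do rewrite addr0.
Qed.

(** The multipliers are the inverse levels. Their constancy from [i] on is recorded for the
    comparison with [objN]. *)
Lemma Phi_dual_eq x : feasible k x -> exists i (s : nat -> R),
  [/\ (i < k)%N, forall j, 0 <= s j, forall j l, (j <= l)%N -> s j <= s l,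
      forall j, (i <= j)%N -> s j = s i &
  Phi k (weighted_gram H x) = \sum_(j < k) 2 * s j
  - \sum_(j < n) s j ^+ 2 * (eigs (weighted_gram H x))`_j].
Proof.
move=> fx; have pY := psd_feasible H fx.
have [_ [_ _ sz _]] := eigs_spectral pY.1.
have k0n : (0 < k <= n)%N by rewrite k_gt0.
have [i [ik ci ->]] := Phi_level k0n pY.
have pos := level_gram_gt0 fx ik ci.
exists i, (fun j => (level k (eigs (weighted_gram H x)) i j)^-1); split=> //.
- by move=> j; rewrite invr_ge0 ltW.
- move=> j l jl; rewrite lef_pV2 ?posrE //.
  exact: (level_nonincr le_kn (fun j l => @eigs_nonincr _ _ _ j l pY.1) ik ci).
- by move=> j ij; rewrite /level ltnn ltnNge ij.
have pos' j : (j < k)%N -> 0 < level k (eigs (weighted_gram H x)) i j + 0.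
  by move=> _; rewrite addr0.
have /= := level_dual_eq sz le_kn ik pos'.
under eq_bigr do rewrite mul0r subr0 addr0.
under [X in _ - X]eq_bigr do rewrite addr0.
by under [RHS]eq_bigr do rewrite addr0.
Qed.

Lemma objM_min : exists2 x, feasible k x &
  forall y, feasible k y -> objM d k H lam x <= objM d k H lam y.
Proof.
apply: feasible_min => // x fx; have pY := psd_feasible H fx.
have [P [PP YP _ _]] := eigs_spectral pY.1.
have [i [s [ik s0 s_le _ PhiE]]] := Phi_dual_eq fx.
have s_le' j l : (j <= l < n)%N -> s j <= s l by case/andP=> /s_le.
exists n, H, (spectral_mx P (fun j => s j ^+ 2)),
  (\sum_(j < k) 2 * s j + (d%:R - k%:R) / lam); split.
  by rewrite (mxtrace_spectral_eigs _ PP YP) addrAC lerD2r PhiE.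
move=> y fy; rewrite addrAC lerD2r; apply: le_trans (Phi_dual_le fy s0 s_le').
rewrite lerD2l lerN2; apply: le_mxtrace_spectral => //.
  exact: (psd_feasible H fy).1.
by move=> j l /s_le'; rewrite ler_pXn2r // nnegrE.
Qed.

Lemma objM_le_objN x : feasible k x -> objM d k H lam x <= objN k A lam x.
Proof.
move=> fx; have pX := psd_feasible A fx.
have [P [PP XP _ _]] := eigs_spectral pX.1.
have [i [s [ik s0 s_le s_i PhiE]]] := Phi_dual_eq fx.
have := @minorant_le_envelope R d kt lam le_ktd lam_gt0 P _ s PP s0
  (fun j l jl => s_le j l (andP jl).1) pX.
rewrite (mxtrace_spectral_eigs _ PP XP) => env.
have sum_const m (g : nat -> R) : \sum_(j < m) (s i ^+ 2 - s j ^+ 2) * g j =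
    s i ^+ 2 * \sum_(j < m) g j - \sum_(j < m) s j ^+ 2 * g j.
  by rewrite mulr_sumr -sumrB; apply: eq_bigr => j _; rewrite mulrBl.
have s2_le j l : (j <= l)%N -> s j ^+ 2 <= s l ^+ 2.
  by move=> /s_le; rewrite ler_pXn2r // nnegrE.
(* The weights [s_i^2 - s_j^2] are nonnegative, nonincreasing and 0 from [i] on, as majorization
   requires. In the result the multiples of [s_i^2] cancel by the trace identity, leaving the sum of
   [s_j^2] against the spectrum for [H] at least that for [A] plus [lam] times the sum of [s_j^2]
   over [j < k]. *)
have v_ge0 j : 0 <= s i ^+ 2 - s j ^+ 2.
  rewrite subr_ge0; case: (leqP i j) => [/s_i ->//|/ltnW]; exact: s2_le.
have v_le j l : (j <= l < n)%N -> s i ^+ 2 - s l ^+ 2 <= s i ^+ 2 - s j ^+ 2.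
  by case/andP=> jl _; rewrite lerD2l lerN2 s2_le.
have := eigs_gram_majorization le_dn lam_gt0 HH fx.1 v_ge0 v_le.
have -> : \sum_(j < n) (s i ^+ 2 - s j ^+ 2) =
    k%:R * s i ^+ 2 - \sum_(j < k) s j ^+ 2.
  transitivity (\sum_(j < k) (s i ^+ 2 - s j ^+ 2)).
    rewrite (big_ord_widen n (fun j => s i ^+ 2 - s j ^+ 2) le_kn) [RHS]big_mkcond.
    apply: eq_bigr => j _; case: ltnP => // kj.
    by rewrite s_i ?subrr // (leq_trans (ltnW ik)).
  by rewrite sumrB sumr_const card_ord mulr_natl.
rewrite !sum_const (sum_eigs_gram HH fx.1) fx.2 => maj.
have := sum_quadratic_le s le_ktk; rewrite [leLHS]sumrB -[X in _ - X <= _]mulr_sumr => quad.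
rewrite /objM /objN -/kt PhiE; lra.
Qed.

End Objectives.

Unset Implicit Arguments.

Theorem theorem5 (R : realType) (d n k : nat) (A : 'M[R]_(d, n)) (lam : R)
    (H : 'M[R]_n)
    (d_gt0 : (0 < d)%N) (le_dn : (d <= n)%N)
    (k_gt0 : (0 < k)%N) (le_kn : (k <= n)%N)
    (lam_gt0 : 0 < lam)
    (cholH : is_cholesky (A^T *m A + lam%:M) H) :
  exists nuC nuM nuN : R,
    [/\ is_min (@feasible R n k) (objC A lam) nuC,
        is_min (@feasible R n k) (objM d k H lam) nuM &
        is_min (@feasible R n k) (objN k A lam) nuN]
    /\ [/\ (d <= k)%N -> nuN = nuC,
           (k < d)%N -> nuC <= nuN &
           nuM <= nuN].
Proof.
have [HH _ _] := cholH.
have [xC fC minC] := objC_min A le_kn lam_gt0.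
have [xM fM minM] := objM_min le_dn k_gt0 le_kn lam_gt0 HH.
have [xN fN minN] := objN_min A d_gt0 k_gt0 le_kn lam_gt0.
exists (objC A lam xC), (objM d k H lam xM), (objN k A lam xN).
split; first by split; exact: is_min_of_minimizer.
(* A pointwise inequality passes to the minima by evaluation at the minimizer of the larger
   objective. *)
have leCN : objC A lam xC <= objN k A lam xN.
  by apply: le_trans (minC _ fN) _; exact: objC_le_objN.
split=> // [dk|].
  apply/le_anti; rewrite leCN andbT; apply: le_trans (minN _ fC) _.
  exact: objN_le_objC.
apply: le_trans (minM _ fN) _; exact: objM_le_objN.
Qed.
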